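(* For all integers $n\ge1$ and $x\ge0$, $$CSTC(2n,2x)=\frac{1}{2^n}\prod_{k=0}^{n-1}\frac{CS(2k+1,2x)}{CS(2k,2x)}.$$
   Context: Work in the regular triangular lattice with unit side. A lozenge is a unit rhombus that is the union of two unit triangles of the lattice sharing an edge; a lozenge tiling of a region (a finite union of unit triangles) is a covering of it by lozenges contained in it, without gaps or overlaps. For integers $m\ge1$, $y\ge0$, $H_{m,y}$ is obtained as follows. Take the lattice hexagon with all angles $120^\circ$ and side lengths $m,m+y,m,m+y,m,m+y$ in cyclic order, and remove from its center the triangular lattice region of side $y$ whose vertices point towards the shorter sides (those of length $m$) of the hexagon. (Equivalently: take a lattice equilateral triangle of side $3m+y$, cut off the three corner triangles of side $m$, and remove the concentric triangle of side $y$ with the same orientation as the large triangle.) $CS(m,y)$ is the number of lozenge tilings of $H_{m,y}$ invariant under the rotation $r$ by $120^\circ$ around the center; by convention $CS(0,y)=1$ (the region $H_{0,y}$ is empty and has exactly one tiling). $CSTC(m,y)$ is the number of lozenge tilings of $H_{m,y}$ invariant under both $r$ and the reflection $t'$ across a symmetry axis of $H_{m,y}$ not containing any vertex of the hexagon, i.e. an axis through the midpoints of two opposite sides. *)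

(* Defs.v *)
From mathcomp Require Import all_boot.

Set Implicit Arguments.
Unset Strict Implicit.
Unset Printing Implicit Defensive.

(* Lattice triangles are described inside an equilateral lattice triangle of
   side N, in barycentric coordinates (p, q, r) with p, q, r >= 0 and
   p + q + r = N; the lattice lines are those on which p, q or r is an integer,
   and the lattice points are the points with three integer coordinates.
   A unit triangle is encoded by the integer parts (i, j, k) of the coordinates
   of its interior points.  There are two kinds:
   - i + j + k = N - 1: the triangle p >= i, q >= j, r >= k, which has the same
     orientation as the big triangle;
   - i + j + k = N - 2: the triangle p <= i + 1, q <= j + 1, r <= k + 1, which
     has the opposite orientation.
   All other triples of the type [cell N] are junk. *)
Notation cell N := ('I_N * 'I_N * 'I_N)%type.

Section Cells.
Variable N : nat.
Implicit Types (c u v : cell N) (L : {set cell N}) (T : {set {set cell N}}).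

Definition co1 c : nat := c.1.1.
Definition co2 c : nat := c.1.2.
Definition co3 c : nat := c.2.

Definition up c : bool := (co1 c + co2 c + co3 c).+1 == N.
Definition down c : bool := (co1 c + co2 c + co3 c).+2 == N.

(* The three sides of the up triangle (i, j, k) lie on the lines p = i, q = j
   and r = k; the triangles across them are (i-1, j, k), (i, j-1, k) and
   (i, j, k-1). *)
Definition share_edge u v : bool :=
  [&& up u, down v &
   [|| [&& co1 u == (co1 v).+1, co2 u == co2 v & co3 u == co3 v],
       [&& co1 u == co1 v, co2 u == (co2 v).+1 & co3 u == co3 v] |
       [&& co1 u == co1 v, co2 u == co2 v & co3 u == (co3 v).+1]]].

Definition lozenge L : bool :=
  [exists u, exists v, share_edge u v && (L == [set u; v])].

Definition lozenge_tiling (D : {set cell N}) T : bool :=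
  partition T D && [forall L in T, lozenge L].

(* The rotation by 120 degrees about the center of the big triangle, and the
   reflection across its median p = q. *)
Definition rot120 c : cell N := (c.1.2, c.2, c.1.1).
Definition refl c : cell N := (c.1.2, c.1.1, c.2).

Definition tiling_image (f : cell N -> cell N) T : {set {set cell N}} :=
  [set f @: L | L : {set cell N} in T].

Definition invariant_tiling (f : cell N -> cell N) T : bool :=
  tiling_image f T == T.

End Cells.

(* The corner of side m at the vertex p = 3m + y is the part p >= 2m + y of the
   big triangle, and the removed concentric triangle of side y is the part
   p, q, r >= m.  The median p = q meets the boundary of the hexagon at the
   midpoints of the sides lying on r = 2m + y (of length m) and on r = 0 (of
   length m + y), so [refl] is a reflection of the required kind; the other two
   are its conjugates by [rot120]. *)
Definition holed_hexagon (m y : nat) : {set cell (3 * m + y)} :=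
  [set c | [&& up c || down c,
               co1 c < 2 * m + y, co2 c < 2 * m + y, co3 c < 2 * m + y &
               ~~ [&& m <= co1 c, m <= co2 c & m <= co3 c]]].

Definition CS (m y : nat) : nat :=
  #|[set T | lozenge_tiling (holed_hexagon m y) T
             && invariant_tiling (@rot120 _) T]|.

Definition CSTC (m y : nat) : nat :=
  #|[set T | [&& lozenge_tiling (holed_hexagon m y) T,
                 invariant_tiling (@rot120 _) T &
                 invariant_tiling (@refl _) T]]|.

(* No special clause is needed for m = 0: the region is then empty. *)
Lemma CS0 (y : nat) : CS 0 y = 1.
Proof.
have H0 : holed_hexagon 0 y = set0 by apply/setP=> c; rewrite !inE /= !andbF.
rewrite /CS H0; apply/eqP/cards1P; exists set0; apply/setP => T.
rewrite !inE /lozenge_tiling partition_set0; case: eqP => //= ->.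
rewrite /invariant_tiling /tiling_image imset0 eqxx andbT.
by apply/forall_inP => L; rewrite inE.
Qed.

(* Main.v *)
(** Quotienting by the rotation, a tiling becomes a family of non-intersecting
    lattice paths in an (m+y) x m rectangle whose left side is glued to its top
    side, so that CS(m,y) is the determinant D_m of I + (C(y+i+j, j)), i, j < m.
    For a tiling that is moreover reflection-invariant the lozenges crossing the
    axes are forced, and a sixth of the hexagon remains, giving
    CSTC(2n,2x) = T_n = det (C(x+i+j, 2j-i)), i, j < n.

    On generating functions, the matrix D acts by
    f(w) |-> f(z) + (1-z)^(-y-1) f(1/(1-z)).  The polynomials f invariant under
    w |-> 1-w are sent to series which, for y = 2x, are combinations with
    coefficients 2 C(x+i+j, 2j-i) of z^(2j) (1-z)^(-x-j-1) (1-z/2).  Both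
    families are triangular, and comparing the last entries of the inverse
    matrices gives D_{2k} / D_{2k+1} = T_k / (2 T_{k+1}); the product over k
    telescopes. *)

Require Import Defs.
From mathcomp Require Import all_boot all_order all_algebra all_fingroup.
From mathcomp Require Import ring zify.

Set Implicit Arguments.
Unset Strict Implicit.
Unset Printing Implicit Defensive.

Import GRing.Theory Num.Theory.

(** * A determinant ratio *)

Local Open Scope ring_scope.

(** Gluing two sides of the rectangle closes the paths up into cycles, so a family of paths has no
    fixed endpoints to start from. It is read instead as a permutation of all positions, those off
    the paths being fixed; non-intersection becomes injectivity, and the families are the terms of
    the Leibniz expansion of a determinant of the size of the rectangle, with entries identity minus
    steps plus teleports. The point to settle is that all signs cancel: a cycle with exactly one
    teleport has the parity of its number of steps. Inverting the part without teleports, which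
    amounts to counting paths, then collapses the determinant to size m or n. The same count shows
    D_m > 0, hence the invertibility that the ratio argument requires. Evenness of y enters twice:
    in a sign of the generating function identity, and in the parity of the coordinates of triangles
    on the axes. *)

Lemma invmx_max (F : fieldType) k (A : 'M[F]_k.+1) : A \in unitmx ->
  invmx A ord_max ord_max = (\det A)^-1 *
    \det (\matrix_(i < k, j < k) A (widen_ord (leqnSn k) i) (widen_ord (leqnSn k) j)).
Proof.
move=> uA; rewrite /invmx uA !mxE /cofactor -signr_odd oddD addbb expr0 mul1r.
congr (_ * \det _); apply/matrixP=> i j; rewrite !mxE.
by congr (A _ _); apply/val_inj; rewrite /= /bump leqNgt ltn_ord.
Qed.

(** Compare the last rows of [E^-1 P = B X^-1]: on the right it is [c] times that of [X^-1], and on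
    the left its last entry is that of [E^-1], since the last column of [P] is a unit vector. The
    full rank of [P *m X = E *m B] makes [E] invertible. *)
Lemma invmx_max_ratio (F : fieldType) k m c (X : 'M[F]_m.+1) (E : 'M_k.+1)
    (P B : 'M_(k.+1, m.+1)) :
  P *m X = E *m B -> (forall i, P i ord_max = (i == ord_max)%:R) ->
  row ord_max B = c *: delta_mx 0 ord_max -> row_free P -> X \in unitmx ->
  E \in unitmx /\
  invmx E ord_max ord_max = c * invmx X ord_max ord_max.
Proof.
move=> PX Pmax Bmax Pfree uX.
have uE : E \in unitmx.
  rewrite -row_free_unit /row_free eqn_leq rank_leq_row /=.
  apply: leq_trans (mxrankM_maxl E B); rewrite -PX mxrankMfree //.
    by rewrite (eqP Pfree).
  by rewrite row_free_unit.
split=> //.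
have h : row ord_max (invmx E *m P) = c *: row ord_max (invmx X).
  rewrite -[LHS](mulmxK uX) -row_mul -mulmxA PX mulKmx // Bmax.
  by rewrite -scalemxAl -rowE.
have := congr1 (fun M : 'rV_m.+1 => M 0 ord_max) h; rewrite !mxE => <-.
rewrite (bigD1 ord_max) //= Pmax eqxx mulr1 big1 ?addr0 // => i /negPf ni.
by rewrite Pmax ni mulr0.
Qed.

(* For z = 1 - q the recurrence [fibpolySS] has characteristic roots 1 and -q. *)
Definition fibpoly (R : comPzRingType) (z q : R) n : R :=
  \sum_(A < n.+1) 'C(A, n - A)%:R * (z ^+ (A + A - n) * q ^+ (n - A)).

Lemma fibpolySS (R : comPzRingType) (z q : R) n :
  fibpoly z q n.+2 = z * fibpoly z q n.+1 + q * fibpoly z q n.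
Proof.
rewrite /fibpoly big_ord_recl bin_small ?mul0r ?add0r //.
rewrite (eq_bigr (fun A : 'I_n.+2 =>
    z * ('C(A, n.+1 - A)%:R * (z ^+ (A + A - n.+1) * q ^+ (n.+1 - A)))
  + q * (if (A <= n)%N then 'C(A, n - A)%:R * (z ^+ (A + A - n) * q ^+ (n - A))
         else 0))); last first.
  move=> A _; rewrite /= /bump /= add1n.
  have -> : (A.+1 + A.+1 - n.+2 = A + A - n)%N by lia.
  have -> : (n.+2 - A.+1 = n.+1 - A)%N by lia.
  have hz : 'C(A, n.+1 - A)%:R * z ^+ (A + A - n) =
            z * ('C(A, n.+1 - A)%:R * z ^+ (A + A - n.+1)) :> R.
    (* The exponent [A + A - n.+1] truncates only if [A + A <= n], and then the binomial coefficient
       vanishes because [n.+1 - A > A]. *)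
    have [h|h] := ltnP n (A + A); last by rewrite bin_small ?mul0r ?mulr0 //; lia.
    rewrite mulrCA -exprS; congr (_ * _ ^+ _); lia.
  rewrite [z * _](_ : _ = ('C(A, n.+1 - A)%:R * z ^+ (A + A - n)) * q ^+ (n.+1 - A));
    last by rewrite hz; ring.
  case: leqP => [le|lt].
    rewrite subSn // binS natrD exprS; ring.
  have -> : (n.+1 - A = 0)%N by lia.
  by rewrite !bin0 mulr0 addr0 mulrA.
rewrite big_split /= -!mulr_sumr; congr (_ + _ * _).
rewrite big_ord_recr /= ltnn addr0; apply: eq_bigr => A _.
by rewrite -ltnS ltn_ord.
Qed.

(** Binet's formula for these roots, cleared of its denominator [1 + q], the difference of the
    roots. *)
Lemma fibpolyE (R : comPzRingType) (q : R) n :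
  (1 + q) * fibpoly (1 - q) q n = 1 - (- q) ^+ n.+1.
Proof.
have [] : (1 + q) * fibpoly (1 - q) q n = 1 - (- q) ^+ n.+1 /\
       (1 + q) * fibpoly (1 - q) q n.+1 = 1 - (- q) ^+ n.+2; last by [].
elim: n => [|n [IH1 IH2]].
  rewrite /fibpoly !big_ord_recl !big_ord0 /=; split=> /=;
  rewrite /bump /= ?bin0 ?bin_small // ?mul0r ?add0r ?addr0;
  rewrite ?subn0 ?addn0 ?subnn ?expr0; ring.
split=> //; rewrite fibpolySS mulrDr mulrCA IH2 mulrCA IH1 !exprS; ring.
Qed.

(** * Congruences modulo a power of the variable *)

Section Truncation.
Variables (R : comNzRingType) (m : nat).
Implicit Types p r s : {poly R}.

Definition eqmodX p r := forall l, (l < m)%N -> p`_l = r`_l.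

Local Notation q := (1 - 'X : {poly R}).
Local Notation "p =m r" := (eqmodX p r) (at level 70).

Lemma eqmodXMr p r s : p =m r -> s * p =m s * r.
Proof.
move=> h l lm; rewrite !coefM; apply: eq_bigr => i _.
by rewrite h // (leq_ltn_trans (leq_subr _ _)).
Qed.

Lemma coef_1subXM p l : (q * p)`_l = p`_l - (if l is l'.+1 then p`_l' else 0).
Proof. by rewrite mulrBl mul1r coefB coefXM; case: l. Qed.

(** With constant coefficient 1, [q] is a unit modulo ['X^m]. Identities between series with powers
    of [q] as denominators can thus be checked on polynomials. *)
Lemma eqmodX_cancel e p r : q ^+ e * p =m q ^+ e * r -> p =m r.
Proof.
elim: e => [|e IH]; first by rewrite !expr0 !mul1r.
rewrite !exprS -!mulrA => h; apply: IH.
elim=> [|l IHl] lm; have := h _ lm; rewrite !coef_1subXM ?subr0 //.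
by rewrite IHl ?(ltnW lm) // => /addIr.
Qed.

(* The truncation of (1 - 'X)^-(c+1). *)
Definition negbin c : {poly R} := \poly_(s < m) 'C(c + s, s)%:R.

Lemma negbin0 : q * negbin 0 =m 1.
Proof.
case=> [|l] lm; rewrite coef_1subXM !coef_poly ?lm ?(ltnW lm) coef1.
  by rewrite subr0 bin0.
by rewrite !add0n !binn subrr.
Qed.

Lemma negbinS c : q * negbin c.+1 =m negbin c.
Proof.
case=> [|l] lm; rewrite coef_1subXM !coef_poly lm ?subr0 ?addn0 ?bin0 //.
by rewrite (ltnW lm) addSn binS addSnnS natrD addrK.
Qed.

Lemma negbinE e c : (c < e)%N -> q ^+ e * negbin c =m q ^+ (e - c.+1).
Proof.
elim: c e => [|c IH] [|e] // ce l lm; rewrite exprSr -mulrA.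
  by rewrite (eqmodXMr _ negbin0) // mulr1 subn1.
by rewrite (eqmodXMr _ (negbinS c)) // IH.
Qed.

End Truncation.

(* C(x+i+j, 2j-i): the lower index x+2i-j is the complementary one, which gives 0 for 2j < i
   in spite of truncated subtraction; the test handles j > x+2i. *)
Definition cstc_entry x i j : nat :=
  if (j <= x + (i + i))%N then 'C(x + i + j, x + (i + i) - j) else 0.

Definition cstc_mx (R : comNzRingType) x n : 'M[R]_n :=
  \matrix_(i, j) (cstc_entry x i j)%:R.

Definition cs_mx (R : comNzRingType) y m : 'M[R]_m :=
  \matrix_(i, j) ((i == j)%:R + 'C(y + i + j, j)%:R).

Section RowIdentity.
Variables (R : comNzRingType) (x k i : nat).
Hypothesis ik : (i <= k)%N.
Let m := (k + k).+1.
Local Notation q := (1 - 'X : {poly R}).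
Local Notation "p =m r" := (eqmodX m p r) (at level 70).

(** The shift [A = x + i + j] of the summation index in [fibpoly] turns ['C(A, n - A)] into
    ['C(x + i + j, x + 2i - j)], and the exponent [A + A - n] into [2j - i]. *)
Lemma fibpoly_cstc :
  \sum_(j < k.+1) (cstc_entry x i j)%:R * ((1 + q) * ('X^(j + j) * q ^+ (x + (k + k) - j)))
  =m 'X^i * q ^+ (k + k - (i + i)) * ((1 + q) * fibpoly 'X q (x + x + (i + i + i))).
Proof.
(* [N] exceeds both [k] and [x + 2i], so the sum can be cut at either place. *)
set n := (x + x + (i + i + i))%N; pose N := (x + (i + i) + k).+1.
pose F j : {poly R} := (cstc_entry x i j)%:R * ((1 + q) * ('X^(j + j) * q ^+ (x + (k + k) - j))).
have -> : 'X^i * q ^+ (k + k - (i + i)) * ((1 + q) * fibpoly 'X q n) = \sum_(j < N) F j.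
  rewrite mulrCA /fibpoly mulr_sumr mulr_sumr.
  pose H A : {poly R} := (1 + q) *
    ('X^i * q ^+ (k + k - (i + i)) * ('C(A, n - A)%:R * ('X^(A + A - n) * q ^+ (n - A)))).
  rewrite -(big_mkord xpredT H) (@big_cat_nat _ _ _ (x + i)) //=; last by rewrite /n; lia.
  rewrite big_nat big1 ?add0r => [|A /andP[_ lA]]; last first.
    by rewrite /H bin_small ?mul0r ?mulr0 //; rewrite /n; lia.
  rewrite -{1}[(x + i)%N]add0n big_addn -(big_mkord xpredT F).
  rewrite [RHS](@big_cat_nat _ _ _ (x + (i + i)).+1) //=; last by rewrite /N; lia.
  rewrite [X in _ = _ + X]big_nat [X in _ = _ + X]big1 ?addr0 => [|A /andP[lA _]]; last first.
    by rewrite /F /cstc_entry leqNgt lA mul0r.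
  have -> : (n.+1 - (x + i) = (x + (i + i)).+1)%N by rewrite /n; lia.
  apply: eq_big_nat => j /andP[_ lj].
  rewrite /H /F /cstc_entry -ltnS lj.
  have -> : (j + (x + i) = x + i + j)%N by lia.
  have -> : (n - (x + i + j) = x + (i + i) - j)%N by rewrite /n; lia.
  have [h|h] := ltnP (x + i + j) (x + (i + i) - j).
    by rewrite bin_small // !(mul0r, mulr0).
  have -> : (x + i + j + (x + i + j) - n = j + j - i)%N by rewrite /n; lia.
  have -> : (x + (k + k) - j = (k + k - (i + i)) + (x + (i + i) - j))%N by lia.
  have -> : 'X^(j + j) = 'X^i * 'X^(j + j - i) :> {poly R} by rewrite -exprD subnKC //; lia.
  rewrite exprD; ring.
(* The terms with [j > k] are multiples of ['X^(2k+2)] and vanish modulo ['X^(2k+1)]. *)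
move=> l lm; have kN : (k.+1 <= N)%N by rewrite /N; lia.
rewrite (big_ord_widen _ F kN) !coef_sum [RHS](bigID (fun j : 'I_N => j < k.+1)%N) /=.
rewrite [X in _ = _ + X]big1 ?addr0 // => j.
rewrite -leqNgt => kj; rewrite /F mulrCA mulrA -mulrCA coefXnM.
by have -> : (l < j + j)%N by move: lm; rewrite /m; lia.
Qed.

Lemma alt_binomial_sum (z : {poly R}) e : 
  \sum_(s < i.+1) 'C(i, s)%:R * (- 1) ^+ (i - s) * z ^+ (i - s) * e ^+ s = (e - z) ^+ i.
Proof.
rewrite addrC exprDn; apply: eq_bigr => s _.
by rewrite -[in RHS]mulN1r exprMn -mulr_natl; ring.
Qed.

(* The left-hand side is the image under D of (w (w - 1))^i, a polynomial invariant under
   w |-> 1 - w. *)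
Lemma cs_row_identity :
  \sum_(s < i.+1) 'C(i, s)%:R * (- 1) ^+ (i - s) * ('X^(i + s) + negbin R m (x + x + (i + s)))
  =m \sum_(j < k.+1) (cstc_entry x i j)%:R * ((1 + q) * ('X^(j + j) * negbin R m (x + j))).
Proof.
(* [negbin c] stands for [q^-(c+1)] with [c <= 2x + 2k], so [q ^+ e] clears every denominator. *)
pose e := (x + x + (k + k)).+1.
apply: (@eqmodX_cancel _ _ e) => l lm.
have -> : (q ^+ e * \sum_(j < k.+1) (cstc_entry x i j)%:R *
    ((1 + q) * ('X^(j + j) * negbin R m (x + j))))`_l
 = (\sum_(j < k.+1) (cstc_entry x i j)%:R * ((1 + q) * ('X^(j + j) * q ^+ (x + (k + k) - j))))`_l.
  rewrite mulr_sumr !coef_sum; apply: eq_bigr => j _.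
  set c := _%:R. 
  transitivity (((c * (1 + q) * 'X^(j + j)) * (q ^+ e * negbin R m (x + j)))`_l).
    by congr ((polyseq _)`_l); ring.
  transitivity (((c * (1 + q) * 'X^(j + j)) * q ^+ (x + (k + k) - j))`_l); last first.
    by congr ((polyseq _)`_l); ring.
  apply: (@eqmodXMr _ m) => //; have := @negbinE R m e (x + j).
  have -> : (e - (x + j).+1 = x + (k + k) - j)%N by rewrite /e; lia.
  by apply; have := ltn_ord j; rewrite /e; lia.
rewrite fibpoly_cstc // (_ : fibpoly 'X = fibpoly (1 - q)); last by rewrite subKr.
rewrite fibpolyE mulr_sumr.
transitivity ((\sum_(s < i.+1) ('C(i, s)%:R * (- 1) ^+ (i - s) * ('X^(i + s) * q ^+ e) +
     'C(i, s)%:R * (- 1) ^+ (i - s) * q ^+ (k + k - (i + s))))`_l).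
  rewrite !coef_sum; apply: eq_bigr => s _.
  set c := _ * (-1) ^+ _.
  rewrite -[c * (_ * _) + _]mulrDr mulrCA.
  apply: (@eqmodXMr _ m) => // l' lm'; rewrite mulrDr !coefD mulrC; congr (_ + _).
  have := @negbinE R m e (x + x + (i + s)).
  have -> : (e - (x + x + (i + s)).+1 = k + k - (i + s))%N by rewrite /e; lia.
  by apply => //; have := ltn_ord s; rewrite /e; lia.
congr ((polyseq _)`_l); rewrite big_split /=.
(* The two halves of the sum are binomial expansions, of [('X - 1) ^+ i] and of
   [(1 - q) ^+ i = 'X^i]. *)
have -> : \sum_(s < i.+1) 'C(i, s)%:R * (- 1) ^+ (i - s) * ('X^(i + s) * q ^+ e) =
   'X^i * q ^+ e * ('X - 1) ^+ i.
  rewrite -alt_binomial_sum mulr_sumr; apply: eq_bigr => s _.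
  by rewrite expr1n exprD; ring.
have -> : \sum_(s < i.+1) 'C(i, s)%:R * (- 1) ^+ (i - s) * q ^+ (k + k - (i + s)) =
   q ^+ (k + k - (i + i)) * 'X^i.
  rewrite -[X in _ * X ^+ _](subKr 1) -alt_binomial_sum mulr_sumr; apply: eq_bigr => s _.
  have -> : (k + k - (i + s) = (k + k - (i + i)) + (i - s))%N.
    by have := ltn_ord s; lia.
  rewrite expr1n exprD; ring.
have -> : 'X - 1 = - q by ring.
rewrite mulrBr mulr1 addrC [q ^+ _ * _]mulrC; congr (_ + _).
rewrite -mulrN -!mulrA; congr (_ * _).
have -> : e = ((k + k - (i + i)) + (x + x + (i + i)).+1)%N by rewrite /e; lia.
rewrite exprD -mulrA; congr (_ * _).
have -> : (x + x + (i + i + i)).+1 = ((x + x + (i + i)).+1 + i)%N by lia.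
rewrite exprD -mulNr; congr (_ * _).
(* Here [y = 2x] matters: this exponent is odd, so the power of [- q] supplies exactly the minus
   sign required. *)
have -> : (x + x + (i + i)).+1 = (x + i).*2.+1 by lia.
by rewrite exprNn -signr_odd /= odd_double expr1 mulN1r opprK.
Qed.

End RowIdentity.

(** Row [i] of [P] lists the coefficients of [(w (w - 1))^i], monic of degree [2i <= m - 1], whence
    its last column. Row [k] of [B] comes from a multiple of ['X^(2k)], so only its last entry
    survives; it is the constant coefficient 2 of [1 + q], the source of the factor 2. *)
Lemma cs_cstc_invmx (F : fieldType) x k :
  let X := cs_mx F (x + x) (k + k).+1 in let E := cstc_mx F x k.+1 in
  X \in unitmx -> E \in unitmx /\
  invmx E ord_max ord_max = 2 * invmx X ord_max ord_max.
Proof.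
move=> X E uX; pose m := (k + k).+1.
(* For [t < i] the truncated [t - i] would give a binomial coefficient 1; the test puts the zero
   there. *)
pose P := \matrix_(i < k.+1, t < m)
  (if (i <= t)%N then 'C(i, t - i)%:R * (-1) ^+ (i + i - t) else 0) : 'M[F]_(_, m).
pose B := \matrix_(j < k.+1, l < m)
  ((1 + (1 - 'X)) * ('X^(j + j) * negbin F m (x + j)))`_l : 'M[F]_(_, m).
apply: (@invmx_max_ratio _ _ _ _ X E P B) => //.
- apply/matrixP=> i l; have ik : (i <= k)%N by rewrite -ltnS.
  have := @cs_row_identity F x k i ik l (ltn_ord l); rewrite !coef_sum => h.
  rewrite !mxE; transitivity (\sum_(j < k.+1) E i j * B j l); last by [].
  transitivity (\sum_(s < i.+1) ('C(i, s)%:R * (-1) ^+ (i - s) *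
       ('X^(i + s) + negbin F m (x + x + (i + s)))`_l)); last first.
    transitivity (\sum_(s < i.+1) ('C(i, s)%:R * (-1) ^+ (i - s) *
       ('X^(i + s) + negbin F m (x + x + (i + s))))`_l).
      apply: eq_bigr => s _; rewrite -coefCM; congr ((polyseq (_ * _))`_l).
      by rewrite rmorphM rmorphXn rmorphN rmorph1 rmorph_nat.
    rewrite h; apply: eq_bigr => j _; rewrite !mxE -coefCM.
    by congr ((polyseq (_ * _))`_l); rewrite rmorph_nat.
  pose H t := (if (i <= t)%N then 'C(i, t - i)%:R * (-1) ^+ (i + i - t) else 0) *
     ('X^t + negbin F m (x + x + t))`_l.
  transitivity (\sum_(t < m) H t).
    apply: eq_bigr => t _; rewrite !mxE /H; congr (_ * _).
    by rewrite coefD coefXn coef_poly ltn_ord eq_sym.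
  rewrite -(big_mkord xpredT H) (@big_cat_nat _ _ _ i) //=; last by rewrite /m; lia.
  rewrite big_nat big1 ?add0r => [|t /andP[_ lt]]; last first.
    by rewrite /H leqNgt lt mul0r.
  rewrite (@big_cat_nat _ _ _ (i.+1 + i)) //=; [| lia | rewrite /m; lia].
  rewrite [X in _ + X]big_nat [X in _ + X]big1 ?addr0 => [|t /andP[lt _]]; last first.
    by rewrite /H bin_small ?mul0r ?if_same ?mul0r //; lia.
  rewrite -{1}[nat_of_ord i]add0n big_addn addnK big_mkord; apply: eq_bigr => s _.
  rewrite /H leq_addl addnK addnC; congr (_ * _ ^+ _ * _); lia.
- move=> i; rewrite mxE /= -val_eqE /=; have := ltn_ord i; rewrite ltnS leq_eqVlt.
  case/orP=> [/eqP->|ik]; first by rewrite leq_addr addKn binn subnn eqxx mulr1.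
  by rewrite bin_small ?mul0r ?if_same ?(ltn_eqF ik) //; lia.
- apply/rowP=> l; rewrite !mxE /= mulrCA coefXnM.
  have := ltn_ord l; rewrite ltnS leq_eqVlt => /orP[/eqP lk|lk].
    have -> : l = ord_max by apply/val_inj.
    rewrite /= eqxx mulr1 ltnn subnn.
    by rewrite mulrDl mul1r coefD coef_1subXM coef_poly /= addn0 bin0 subr0.
  by rewrite lk -val_eqE /= (ltn_eqF lk) mulr0.
(* The columns of [P] of even index [2j] form a unitriangular matrix, since [2j - i > i] for
   [i < j]; this gives full row rank. *)
have inj2 (j : 'I_k.+1) : (j + j < m)%N by rewrite /m; have := ltn_ord j; lia.
pose C : 'M[F]_(m, k.+1) := \matrix_(t, j) (t == (j + j)%N :> nat)%:R.
have PC i j : (P *m C) i j = P i (Ordinal (inj2 j)).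
  rewrite mxE (bigD1 (Ordinal (inj2 j))) //= [C _ _]mxE eqxx mulr1 big1 ?addr0 // => t.
  by rewrite -val_eqE /= => /negPf nt; rewrite [C _ _]mxE nt mulr0.
have uPC : P *m C \in unitmx.
  rewrite unitmxE det_trig.
    rewrite big1 ?unitr1 // => i _; rewrite PC mxE /= leq_addr addKn binn.
    by rewrite subnn mulr1.
  apply/is_trig_mxP => i j ij; rewrite PC mxE /= bin_small ?mul0r ?if_same //; lia.
rewrite /row_free eqn_leq rank_leq_row /= -{1}(mxrank_unit uPC).
exact: mxrankM_maxl.
Qed.

Lemma prod_cs_ratio (F : fieldType) x n :
  (2 : F) != 0 -> (forall m, \det (cs_mx F (x + x) m) != 0) ->
  \prod_(0 <= k < n)
    (\det (cs_mx F (x + x) (2 * k + 1)) / \det (cs_mx F (x + x) (2 * k)))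
  = 2 ^+ n * \det (cstc_mx F x n).
Proof.
move=> nz2 nzX; elim: n => [|n IH].
  by rewrite big_nil expr0 det_mx00 mulr1.
rewrite big_nat_recr //= IH mul2n addn1 -addnn.
have uX : cs_mx F (x + x) (n + n).+1 \in unitmx by rewrite unitmxE unitfE.
have [uE] := cs_cstc_invmx uX; rewrite !invmx_max //.
have -> : \matrix_(i < n, j < n) cstc_mx F x n.+1 (widen_ord (leqnSn n) i)
    (widen_ord (leqnSn n) j) = cstc_mx F x n by apply/matrixP=> i j; rewrite !mxE.
have -> : \matrix_(i < n + n, j < n + n) cs_mx F (x + x) (n + n).+1
    (widen_ord (leqnSn (n + n)) i) (widen_ord (leqnSn (n + n)) j) = cs_mx F (x + x) (n + n).
  by apply/matrixP=> i j; rewrite !mxE -val_eqE.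
move: (nzX (n + n)%N) (nzX (n + n).+1).
move: uE; rewrite unitmxE unitfE.
set t := \det (cstc_mx _ _ n); set t' := \det _; set d := \det _; set d' := \det _.
move=> t'0 d0 d'0 h; rewrite exprS.
have -> : t = t' * (2 * (d'^-1 * d)) by rewrite -h mulVKf.
by field; rewrite d0 d'0.
Qed.

Local Close Scope ring_scope.

(** * The sign of a family of non-intersecting lattice paths *)

(* [s] moves the points of [X] (exits) anywhere, and each other non-fixed point one time unit
   down with [ps] decreasing by at most 1.  Points alive at a given time keep their order, and the
   paths enter and leave at the minimal end: they form a stack.  The height of a point in the stack
   is therefore invariant under [s] and tells the exits apart, so every active cycle of [s] contains
   exactly one exit. *)
Section PathSign.
Variables (T : finType) (s : {perm T}) (X : {set T}) (tm ps : T -> nat).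

Definition active := [set x | (x \in X) || (s x != x)].

Hypothesis step : forall x, x \in active -> x \notin X ->
  tm x = (tm (s x)).+1 /\ ps (s x) <= ps x <= (ps (s x)).+1.
Hypothesis tm_ps_inj : forall x z, tm x = tm z -> ps x = ps z -> x = z.
Hypothesis exit_min : forall x z, x \in X -> z \in active -> tm z = tm x -> ps x <= ps z.
Hypothesis entry_min :
  forall x z, x \in X -> z \in active -> tm z = tm (s x) -> ps (s x) <= ps z.
Hypothesis exit_entry_order :
  {in X &, forall x x', (tm (s x) <= tm (s x')) = (tm x' <= tm x)}.
Hypothesis entry_before_exit : {in X &, forall x x', tm x <= tm (s x')}.

Let X_active x : x \in X -> x \in active.
Proof. by rewrite inE => ->. Qed.

Lemma active_s x : (s x \in active) = (x \in active).
Proof.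
rewrite !inE; case e : (s x == x); first by rewrite !(eqP e) eqxx.
by rewrite (inj_eq perm_inj) e !orbT.
Qed.

(** Counted from the end opposite to the exits and entries, so that paths entering or leaving do not
    change the height of the others. *)
Definition stack_height x := #|[set z in active | (tm z == tm x) && (ps x <= ps z)]|.
Definition stack_size t := #|[set z in active | tm z == t]|.

(** [s] carries the points counted for [x] onto those counted for [s x]. Positions drop by at most
    one, so an inversion of the order would force two points to coincide; exits and entries of the
    same time lie strictly below and are counted on neither side. *)
Lemma stack_height_step x : x \in active -> x \notin X -> stack_height (s x) = stack_height x.
Proof.
move=> ax nX; rewrite /stack_height -[RHS](card_imset _ (@perm_inj _ s)).
have [tx /andP[lx ux]] := step ax nX.
apply/eq_card => w; rewrite -{1 2}[w](permKV s); set z := (s^-1 w)%g.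
rewrite (mem_imset _ _ (@perm_inj _ s)) !inE -!/(_ \in active).
have -> : ((s z \in X) || (s (s z) != s z)) = ((z \in X) || (s z != z)).
  by move: (active_s z); rewrite !inE.
have -> : ((z \in X) || (s z != z)) = (z \in active) by rewrite inE.
case az : (z \in active) => //=.
have [zX|zX] := boolP (z \in X).
  apply/andP/andP=> [[/eqP tz pz]|[/eqP tz pz]]; exfalso; move/negP: nX; apply.
    suff /perm_inj <- : s z = s x by [].
    apply: tm_ps_inj => //; apply/eqP; rewrite eqn_leq pz andbT.
    by apply: entry_min => //; rewrite active_s.
  suff <- : z = x by [].
  by apply: tm_ps_inj => //; apply/eqP; rewrite eqn_leq pz andbT; apply: exit_min.
have [tz /andP[lz uz]] := step az zX.
rewrite tz tx eqSS; case: eqP => //= tzx.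
have := @tm_ps_inj z x; have := @tm_ps_inj (s z) (s x).
rewrite tz tx tzx => /(_ erefl) h1 /(_ erefl) h2.
apply/idP/idP => h; rewrite leqNgt; apply/negP => h'.
  have : s z = s x by apply: h1; lia.
  by move=> /perm_inj e; move: h'; rewrite e ltnn.
have : z = x by apply: h2; lia.
by move=> e; move: h'; rewrite e ltnn.
Qed.

(** Conservation, with time running downwards: the paths present at time [t] and those that have
    already left make up those that have entered. It follows from counting the active points of time
    at least [t] both directly and through [s]. *)
Lemma stack_size_balance t :
  stack_size t + #|[set x in X | t < tm x]| = #|[set x in X | t <= tm (s x)]|.
Proof.
pose A u := [set z in active | u <= tm z].
have e1 : #|A t| = stack_size t + #|A t.+1|.
  rewrite -cardsUI addnC (_ : _ :&: _ = set0) ?cards0.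
    by apply: eq_card => z; rewrite !inE; case: (_ || _) => //=; lia.
  by apply/setP=> z; rewrite !inE; case: (_ || _) => //=; lia.
have e2 : #|A t| = #|[set z in active | t <= tm (s z)]|.
  rewrite -[RHS](card_imset _ (@perm_inj _ s)); apply: eq_card => w.
  rewrite -[w](permKV s) (mem_imset _ _ (@perm_inj _ s)).
  by have := active_s (s^-1 w)%g; rewrite !inE => ->.
have spl (Q : pred T) : #|[set z in active | Q z]| =
    #|[set z in X | Q z]| + #|[set z in active :\: X | Q z]|.
  rewrite -cardsUI addnC (_ : _ :&: _ = set0) ?cards0.
    by apply: eq_card => z; rewrite !inE; case: (z \in X) => //=; rewrite orbF.
  by apply/setP=> z; rewrite !inE; case: (z \in X) => //=; rewrite ?andbF.
have e3 : #|[set z in active :\: X | t <= tm (s z)]| = #|[set z in active :\: X | t < tm z]|.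
  apply: eq_card => z; rewrite !inE; have [|nX /=] := boolP (z \in X) => //=.
  case nz : (s z != z) => //=.
  by have [] := @step z _ nX; [rewrite inE nz orbT | move=> ->].
move: e1; rewrite e2 /A !spl e3; lia.
Qed.

Lemma stack_height_exit x : x \in X -> stack_height x = stack_size (tm x).
Proof.
move=> xX; apply: eq_card => z; rewrite inE [in RHS]inE.
case az : (z \in active) => //=; case: eqP => //= tz.
by rewrite exit_min.
Qed.

Lemma stack_height_entry x : x \in X -> stack_height (s x) = stack_size (tm (s x)).
Proof.
move=> xX; apply: eq_card => z; rewrite inE [in RHS]inE.
case az : (z \in active) => //=; case: eqP => //= tz.
by rewrite entry_min.
Qed.

Lemma stack_size_exit x : x \in X -> stack_size (tm x) = #|[set z in X | tm z <= tm x]|.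
Proof.
move=> xX; have := stack_size_balance (tm x).
have -> : [set z in X | tm x <= tm (s z)] = X.
  by apply/setP=> z; rewrite inE; case zX : (z \in X) => //=; rewrite entry_before_exit.
have -> : #|X| = #|[set z in X | tm z <= tm x]| + #|[set z in X | tm x < tm z]|.
  rewrite -cardsUI addnC (_ : _ :&: _ = set0) ?cards0.
    by apply: eq_card => z; rewrite !inE; case: (z \in X) => //=; lia.
  by apply/setP=> z; rewrite !inE; case: (z \in X) => //=; lia.
exact: addIn.
Qed.

Lemma stack_size_entry x : x \in X -> stack_size (tm (s x)) = #|[set z in X | tm z <= tm x]|.
Proof.
move=> xX; have := stack_size_balance (tm (s x)).
have -> : [set z in X | tm (s x) < tm z] = set0.
  apply/setP=> z; rewrite !inE; case zX : (z \in X) => //=.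
  by rewrite ltnNge entry_before_exit.
rewrite cards0 addn0 => ->; apply: eq_card => z; rewrite !inE.
by case zX : (z \in X) => //=; rewrite exit_entry_order.
Qed.

(** For a teleport, both heights are the number of exits of time at most [tm x]: all paths enter
    before any leaves, and the entries come in the order opposite to their exits, as in a last-in
    first-out discipline. *)
Lemma stack_height_perm x : x \in active -> stack_height (s x) = stack_height x.
Proof.
move=> ax; have [xX|] := boolP (x \in X); last exact: stack_height_step.
by rewrite stack_height_entry // stack_height_exit // stack_size_entry // stack_size_exit.
Qed.

Lemma stack_height_inj_exits : {in X &, injective stack_height}.
Proof.
move=> x x' xX x'X; rewrite !stack_height_exit // !stack_size_exit // => h.
wlog le : x x' xX x'X h / tm x <= tm x'.
  by move=> H; case/orP: (leq_total (tm x) (tm x')) => /H; [|move=> h'; apply/esym; exact: h'] => ->.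
have /eqP e : [set z in X | tm z <= tm x] == [set z in X | tm z <= tm x'].
  rewrite eqEcard h leqnn andbT; apply/subsetP=> z; rewrite !inE => /andP[-> /=].
  by move/leq_trans; apply.
move/setP/(_ x'): e; rewrite !inE x'X leqnn /= => le'.
have tt : tm x = tm x' by lia.
apply: tm_ps_inj => //; apply/eqP; rewrite eqn_leq !exit_min //; exact: X_active.
Qed.

Lemma stack_height_porbit x z : x \in active -> z \in porbit s x ->
  z \in active /\ stack_height z = stack_height x.
Proof.
move=> ax /porbitP[i ->]; elim: i => [|i [ai IH]]; first by rewrite expg0 perm1.
by rewrite expgSr permM active_s stack_height_perm.
Qed.

(** Away from the exits [tm] drops at every step, which cannot go on forever. *)
Lemma porbit_meets_exits x : x \in active -> exists2 z, z \in X & z \in porbit s x.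
Proof.
move tx : (tm x) => t; elim: t x tx => [|t IH] x tx ax;
  have [xX|nX] := boolP (x \in X); try by exists x => //; exact: porbit_id.
  by have [] := step ax nX; rewrite tx.
have [] := step ax nX; rewrite tx => -[t' _].
have [||z zX zs] := IH (s x); rewrite ?active_s //.
by exists z => //; move: zs; rewrite (porbit_perm s 1) ?expg1.
Qed.

(** The sign is the parity of the number of points minus the number of orbits. The inactive points
    together with the exits represent each orbit once. *)
Lemma odd_perm_paths : odd_perm s = odd #|active :\: X|.
Proof.
have fix_orbit x z : x \notin active -> z \in porbit s x -> z = x.
  rewrite inE negb_or negbK => /andP[_ /eqP sx] /porbitP[i ->].
  by rewrite permX; elim: i => //= i ->.
have orbits : porbits s = [set porbit s x | x in ~: active :|: X].
  apply/setP=> O; apply/imsetP/imsetP => [[x _ ->]|[x _ ->]]; last by exists x.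
  have [ax|nx] := boolP (x \in active); last by exists x => //; rewrite in_setU in_setC nx.
  have [z zX zx] := porbit_meets_exits ax; exists z; first by rewrite inE zX orbT.
  by apply/esym/eqP; rewrite eq_porbit_mem.
have orbit_inj : {in ~: active :|: X &, injective (porbit s)}.
  move=> x z; rewrite !(in_setU, in_setC) => hx hz /eqP; rewrite eq_porbit_mem => xz.
  case/orP: hz => [nz|zX]; first exact: fix_orbit xz.
  case/orP: hx => [nx|xX]; first by apply/esym/fix_orbit; rewrite 1?porbit_sym.
  by apply: stack_height_inj_exits => //; have [] := stack_height_porbit (X_active zX) xz.
have disj : ~: active :&: X = set0.
  by apply/setP=> z; rewrite !inE; case: (z \in X); rewrite ?andbF.
have XA : X \subset active by apply/subsetP => z /X_active.
rewrite /odd_perm orbits card_in_imset // cardsU disj cards0 subn0 -(cardsC active).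
rewrite cardsD (setIidPr XA) !oddD oddB ?subset_leq_card //.
by case: (odd _); case: (odd _); case: (odd _).
Qed.
End PathSign.

Local Open Scope ring_scope.

(** * Determinants counting lattice paths with teleports *)

(* A pair [(s, b)] encodes a successor [s x] of each point [x], with [b x] telling whether the move
   is a teleport; the bit matters when a teleport and an ordinary move have the same target (which
   happens around the center when there is no hole). *)
Section PermutationCount.
Variables (T : finType) (step tele : rel T) (free : pred T).

Definition valid_choice (p : {perm T} * {ffun T -> bool}) : bool :=
  [forall x, if p.2 x then tele x (p.1 x)
             else free x && ((p.1 x == x) || step x (p.1 x))].

(** An ordinary move to another point weighs -1, a teleport or a fixed point +1. A point that is not
    [free] can only teleport. *)
Definition choice_weight x z : int :=
  (tele x z)%:R + (free x)%:R * ((x == z)%:R - (step x z)%:R).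

Hypothesis step_irr : irreflexive step.
Hypothesis valid_sign : forall p, valid_choice p ->
  odd_perm p.1 = odd #|[set x | ~~ p.2 x && (p.1 x != x)]|.

(** Distributing the product over the bits gives one term for each pair; for a valid one the product
    of weights is the sign of the permutation, by [valid_sign], and the term is 1. *)
Lemma sum_sign_choice_weight :
  \sum_(s : {perm T}) (-1) ^+ s * \prod_x choice_weight x (s x) =
  #|[set p | valid_choice p]|%:R.
Proof.
pose w x z (b : bool) : int := if b then (tele x z)%:R
  else (free x)%:R * ((x == z)%:R - (step x z)%:R).
transitivity (\sum_(p : {perm T} * {ffun T -> bool})
    (-1) ^+ p.1 * \prod_x w x (p.1 x) (p.2 x)).
  rewrite -(pair_bigA _ (fun (s : {perm T}) (b : {ffun T -> bool}) =>
    (-1) ^+ s * \prod_x w x (s x) (b x))) /=.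
  apply: eq_bigr => s _; rewrite -big_distrr /=; congr (_ * _).
  rewrite -(bigA_distr_bigA (fun x b => w x (s x) b)); apply: eq_bigr => x _.
  by rewrite big_bool.
rewrite -sum1_card natr_sum [RHS]big_mkcond /=; apply: eq_bigr => p _.
rewrite inE; case: ifP => [vp|/negP nvp]; last first.
  apply/eqP; rewrite mulf_eq0; apply/orP; right.
  apply/prodf_eq0; move/negP: nvp; rewrite negb_forall => /existsP[x hx].
  rewrite /w; exists x => //; move: hx; case: (p.2 x) => [/negPf->//|].
  rewrite negb_and => /orP[/negPf->|]; first by rewrite mul0r.
  by rewrite negb_or eq_sym => /andP[/negPf-> /negPf->]; rewrite subrr mulr0.
have -> : \prod_x w x (p.1 x) (p.2 x) =
    (-1) ^+ #|[set x | ~~ p.2 x && (p.1 x != x)]|.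
  rewrite -sum1_card expr_sum [RHS]big_mkcond /=; apply: eq_bigr => x _.
  move/forallP/(_ x): vp; rewrite inE /w; case: (p.2 x) => [->//|] /=.
  case/andP=> -> /=; rewrite mul1r; case: eqVneq => [->|nx /=].
    by rewrite step_irr subr0.
  by move=> ->; rewrite sub0r.
by rewrite valid_sign // signr_odd -exprD addnn -mul2n exprM sqrrN expr1n.
Qed.
End PermutationCount.

Section Grid.
Variables M m : nat.
Notation T := 'I_#|{: 'I_M * 'I_m}|.

(** Positions are numbered by an ordinal because they index matrices; [gcol] and [grow] decode the
    two coordinates. *)
Definition gcol (x : T) : nat := (enum_val x).1.
Definition grow (x : T) : nat := (enum_val x).2.

Lemma ltn_gcol x : (gcol x < M)%N. Proof. exact: ltn_ord. Qed.
Lemma ltn_grow x : (grow x < m)%N. Proof. exact: ltn_ord. Qed.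

Lemma grid_inj x z : gcol x = gcol z -> grow x = grow z -> x = z.
Proof.
rewrite /gcol /grow => h1 h2; apply: enum_val_inj.
case: (enum_val x) (enum_val z) h1 h2 => [a b] [c d] /= h1 h2.
by congr (_, _); apply: val_inj.
Qed.

Definition point a k (ha : (a < M)%N) (hk : (k < m)%N) : T :=
  enum_rank (Ordinal ha, Ordinal hk).

Lemma gcol_point a k ha hk : gcol (@point a k ha hk) = a.
Proof. by rewrite /gcol enum_rankK. Qed.

Lemma grow_point a k ha hk : grow (@point a k ha hk) = k.
Proof. by rewrite /grow enum_rankK. Qed.

Definition left_step x z := (gcol x == (gcol z).+1) && (grow x == grow z).
Definition down_step x z := (gcol x == gcol z) && (grow x == (grow z).+1).
Definition grid_step x z := left_step x z || down_step x z.

Lemma grid_step_irr : irreflexive grid_step.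
Proof. by move=> x; rewrite /grid_step /left_step /down_step; lia. Qed.

Definition npaths a k a' k' : nat :=
  if (a' <= a)%N && (k' <= k)%N then 'C((a - a') + (k - k'), a - a') else 0.

Definition step_mx : 'M[int]_#|{: 'I_M * 'I_m}| :=
  \matrix_(x, z) ((x == z)%:R - (grid_step x z)%:R).

Definition paths_mx : 'M[int]_#|{: 'I_M * 'I_m}| :=
  \matrix_(x, z) (npaths (gcol x) (grow x) (gcol z) (grow z))%:R.

Lemma npaths_rec a k a' k' :
  (npaths a k a' k' = ((a == a') && (k == k')) +
    (if a is b.+1 then npaths b k a' k' else 0) +
    (if k is l.+1 then npaths a l a' k' else 0))%N.
Proof.
rewrite /npaths; have [lea|lta] := leqP a' a; last first.
  rewrite (ltn_eqF lta) /=; case: a lta => [|a] lta; first by case: k.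
  by rewrite [(a' <= a)%N]leqNgt (ltnW lta); case: k.
have [lek|ltk] := leqP k' k; last first.
  rewrite (ltn_eqF ltk) !andbF /=.
  by case: a {lea} => [|a]; rewrite ?andbF; case: k ltk => [|k] ltk //;
     rewrite [(k' <= k)%N]leqNgt (ltnW ltk) ?andbF.
rewrite -(subnK lea) -(subnK lek) !addnK; move: (a - a')%N (k - k')%N => u v {lea lek}.
have eqD w b : (w + b == b)%N = (w == 0)%N by rewrite -{2}[b]add0n eqn_add2r.
rewrite !eqD; case: u => [|u]; case: v => [|v] /=.
- by rewrite !add0n; case: a'; case: k' => *; rewrite ?ltnn ?andbF.
- by rewrite !add0n leq_addl addnK !bin0; case: a' => [|a']; rewrite ?ltnn.
- rewrite !add0n leq_addl addnK !addn0 !binn andbT.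
  by case: k' => [|k']; rewrite ?ltnn.
by rewrite !leq_addl /= !addnK add0n addSn binS addnS addnC addSn.
Qed.

Lemma sum_left_step x (F : T -> int) (f : nat -> nat -> int) :
  (forall z, F z = f (gcol z) (grow z)) ->
  \sum_z (grid_step x z)%:R * F z =
    (if gcol x is b.+1 then f b (grow x) else 0) +
    (if grow x is l.+1 then f (gcol x) l else 0).
Proof.
move=> Ff.
have -> : \sum_z (grid_step x z)%:R * F z =
    \sum_z (left_step x z)%:R * F z + \sum_z (down_step x z)%:R * F z.
  rewrite -big_split /=; apply: eq_bigr => z _; rewrite -mulrDl -natrD; congr (_%:R * _).
  rewrite /grid_step /left_step /down_step.
  by do 4 (case: eqP => ? //=); exfalso; lia.
have single (P : pred T) z0 : P =1 pred1 z0 -> \sum_z (P z)%:R * F z = F z0.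
  move=> hP; rewrite (bigD1 z0) //= hP /= eqxx mul1r big1 ?addr0 // => z /negPf nz.
  by rewrite hP /= nz mul0r.
have none (P : pred T) : P =1 pred0 -> \sum_z (P z)%:R * F z = 0.
  by move=> hP; apply: big1 => z _; rewrite hP mul0r.
have hc := ltn_gcol x; have hr := ltn_grow x; congr (_ + _).
  case ex : (gcol x) => [|b].
    by apply: none => z; rewrite /left_step ex.
  have hb : (b < M)%N by rewrite ex in hc; exact: ltnW.
  rewrite (single _ (point hb hr)) ?Ff ?gcol_point ?grow_point // => z.
  rewrite /left_step ex eqSS /=; apply/andP/eqP => [[/eqP h /eqP h']|->].
    by apply: grid_inj; rewrite ?gcol_point ?grow_point.
  by rewrite gcol_point grow_point !eqxx.
case ex : (grow x) => [|b].
  by apply: none => z; rewrite /down_step ex andbF.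
have hb : (b < m)%N by rewrite ex in hr; exact: ltnW.
rewrite (single _ (point hc hb)) ?Ff ?gcol_point ?grow_point // => z.
rewrite /down_step ex eqSS /=; apply/andP/eqP => [[/eqP h /eqP h']|->].
  by apply: grid_inj; rewrite ?gcol_point ?grow_point.
by rewrite gcol_point grow_point !eqxx.
Qed.

(** A path is empty or a step followed by a path, so the matrix of path counts inverts the identity
    minus the steps. *)
Lemma step_paths_mx : step_mx *m paths_mx = 1%:M.
Proof.
apply/matrixP=> x w; rewrite !mxE.
under eq_bigr do rewrite mxE mulrBl.
rewrite sumrB (bigD1 x) //= eqxx mul1r big1 ?addr0; last first.
  by move=> z; rewrite eq_sym => /negPf->; rewrite mul0r.
rewrite (@sum_left_step x _ (fun a k => (npaths a k (gcol w) (grow w))%:R)); last first.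
  by move=> z; rewrite mxE.
rewrite mxE npaths_rec !natrD.
have -> : ((gcol x == gcol w) && (grow x == grow w))%:R = (x == w)%:R :> int.
  congr (_%:R); congr nat_of_bool; apply/andP/eqP => [[/eqP h /eqP h']|->//].
  exact: grid_inj.
by case: (gcol x) => [|a]; case: (grow x) => [|k] /=; ring.
Qed.
End Grid.

(** The Weinstein-Aronszajn identity: both products of block triangular matrices equal the matrix
    with rows [(1, -P)] and [(Q, 1)]. *)
Lemma det_1DmulC (R : comNzRingType) s r (P : 'M[R]_(s, r)) (Q : 'M_(r, s)) :
  \det (1%:M + P *m Q) = \det (1%:M + Q *m P).
Proof.
have e : block_mx (1%:M + P *m Q) (- P) 0 1%:M *m block_mx 1%:M 0 Q 1%:M =
         block_mx 1%:M 0 Q 1%:M *m block_mx 1%:M (- P) 0 (1%:M + Q *m P).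
  rewrite !mulmx_block !(mulmx0, mul0mx, mul1mx, mulmx1, addr0, add0r).
  by rewrite mulNmx addrK mulmxN [_ + Q *m P]addrC addKr.
move/(congr1 determinant): e.
by rewrite !det_mulmx !det_ublock !det_lblock !det1 !mul1r !mulr1.
Qed.

Section Teleport.
Variables M m r : nat.
Notation T := 'I_#|{: 'I_M * 'I_m}|.
Variables exit entry : 'I_r -> T.
Hypothesis exit_inj : injective exit.

Definition teleport x z := [exists i, (x == exit i) && (z == entry i)].
Definition is_exit x := [exists i, x == exit i].

Lemma teleport_exit i z : teleport (exit i) z = (z == entry i).
Proof.
apply/existsP/eqP => [[j /andP[/eqP/exit_inj-> /eqP->]]//|->].
by exists i; rewrite !eqxx.
Qed.

Let P : 'M[int]_(_, r) := \matrix_(x, i) (x == exit i)%:R.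
Let Q : 'M[int]_(r, _) := \matrix_(i, z) (z == entry i)%:R.

Let pick1 (F : T -> int) z0 : \sum_z (z == z0)%:R * F z = F z0.
Proof.
rewrite (bigD1 z0) //= eqxx mul1r big1 ?addr0 // => z /negPf->.
by rewrite mul0r.
Qed.

Let teleportE : \matrix_(x, z) (teleport x z)%:R = P *m Q.
Proof.
apply/matrixP=> x z; rewrite !mxE; have [/existsP[i /eqP->]|nx] := boolP (is_exit x).
  rewrite teleport_exit (bigD1 i) //= !mxE eqxx mul1r big1 ?addr0 // => j ji.
  by rewrite !mxE (inj_eq exit_inj) eq_sym (negPf ji) mul0r.
rewrite big1 => [|i _].
  rewrite (_ : teleport x z = false) //; apply: contraNF nx => /existsP[i /andP[xi _]].
  by apply/existsP; exists i.
by rewrite mxE; case: eqP nx => [->/existsP[]|_ _]; [exists i | rewrite mul0r].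
Qed.

Definition links := \matrix_(i < r, j < r)
  ((npaths (gcol (entry i)) (grow (entry i)) (gcol (exit j)) (grow (exit j)))%:R : int).

Let linksE : Q *m paths_mx M m *m P = links.
Proof.
apply/matrixP=> i j; rewrite mxE.
under eq_bigr => z _ do rewrite [P _ _]mxE mulrC.
rewrite pick1 mxE; under eq_bigr => z _ do rewrite [Q _ _]mxE.
by rewrite pick1 !mxE.
Qed.

Hypothesis det_step : \det (step_mx M m) = 1.

Let det_NK K : \det K = \det (K *m paths_mx M m).
Proof.
rewrite -[LHS]mulr1 -(det1 _ #|{: 'I_M * 'I_m}|) -(step_paths_mx M m) !det_mulmx.
by rewrite det_step mul1r.
Qed.

(* The matrix is N + P Q with N the step matrix, and N^-1 counts lattice paths. *)
Lemma det_optional_teleport :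
  \det (\matrix_(x, z) choice_weight (@grid_step M m) teleport xpredT x z) =
  \det (1%:M + links).
Proof.
have -> : \matrix_(x, z) choice_weight (@grid_step M m) teleport xpredT x z =
    P *m Q + step_mx M m.
  rewrite -teleportE; apply/matrixP=> x z.
  by rewrite !mxE /choice_weight mul1r.
rewrite det_NK mulmxDl step_paths_mx addrC -mulmxA det_1DmulC.
by rewrite linksE.
Qed.

(** Forcing the exits to teleport erases their rows in the step matrix [N], that is, subtracts
    [P P^T N]. After multiplication by [N^-1] and exchange of the factors, the term [P^T P = 1]
    cancels the identity beside [links]. *)
Lemma det_forced_teleport :
  \det (\matrix_(x, z) choice_weight (@grid_step M m) teleport (predC is_exit) x z) =
  \det links.
Proof.
have PP : P^T *m P = 1%:M.
  apply/matrixP=> i j; rewrite mxE.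
  under eq_bigr => z _ do rewrite [P^T _ _]mxE [P _ _]mxE.
  by rewrite pick1 !mxE (inj_eq exit_inj).
have PPN x z : (P *m (P^T *m step_mx M m)) x z = (is_exit x)%:R * step_mx M m x z.
  rewrite mxE; have [/existsP[i /eqP->]|nx] := boolP (is_exit x).
    rewrite (bigD1 i) //= [P _ _]mxE eqxx !mul1r big1 ?addr0 => [|j ji]; last first.
      by rewrite [P _ _]mxE (inj_eq exit_inj) eq_sym (negPf ji) mul0r.
    rewrite mxE; under eq_bigr => w _ do rewrite [P^T _ _]mxE [P _ _]mxE.
    exact: pick1.
  rewrite mul0r big1 // => i _.
  by rewrite [P _ _]mxE; case: eqP nx => [->/existsP[]|_ _]; [exists i | rewrite mul0r].
have -> : \matrix_(x, z) choice_weight (@grid_step M m) teleport (predC is_exit) x z =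
    P *m Q + step_mx M m - P *m (P^T *m step_mx M m).
  rewrite -teleportE; apply/matrixP=> x z.
  rewrite mxE [RHS]mxE [X in _ = _ + X]mxE PPN !mxE /choice_weight /=.
  by case: (is_exit x); rewrite ?mul0r ?mul1r ?subr0 ?addr0 ?addrK.
rewrite det_NK !mulmxDl mulNmx -!mulmxA step_paths_mx mulmx1.
rewrite addrAC addrC -mulmxBr det_1DmulC mulmxBl linksE PP.
by rewrite addrC subrK.
Qed.

End Teleport.

Section GridSign.
Variables M m : nat.
Notation T := 'I_#|{: 'I_M * 'I_m}|.
Variables (tele : rel T) (free : pred T).

Definition time (x : T) : nat := (gcol x + grow x)%N.

Definition moving (p : {perm T} * {ffun T -> bool}) := active p.1 [set x | p.2 x].

Lemma moving_step p x : valid_choice (@grid_step M m) tele free p ->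
  x \in moving p -> ~~ p.2 x -> free x /\ grid_step x (p.1 x).
Proof.
move=> /forallP/(_ x); rewrite !inE; case: (p.2 x) => //= /andP[-> h] nx _.
by move: h; rewrite (negPf nx).
Qed.

Lemma valid_tele p x : valid_choice (@grid_step M m) tele free p -> p.2 x -> tele x (p.1 x).
Proof. by move=> /forallP/(_ x) h px; rewrite px in h. Qed.

(** The antidiagonals serve as time and the columns as position: a left step lowers both by one, a
    down step only the time. *)
Lemma grid_valid_sign p : valid_choice (@grid_step M m) tele free p ->
  (forall x w z, tele x w -> z \in moving p -> time z = time x -> gcol x <= gcol z)%N ->
  (forall x w z, tele x w -> z \in moving p -> time z = time w -> gcol w <= gcol z)%N ->
  (forall x w x' w', tele x w -> tele x' w' ->
     (time w <= time w')%N = (time x' <= time x)%N /\ (time x <= time w')%N) ->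
  odd_perm p.1 = odd #|[set x | ~~ p.2 x && (p.1 x != x)]|.
Proof.
move=> vp exit_min entry_min tele_time.
have tl x : x \in [set x | p.2 x] -> tele x (p.1 x) by rewrite inE => /(valid_tele vp).
rewrite (@odd_perm_paths _ p.1 [set x | p.2 x] time (@gcol M m)).
- by congr (odd _); apply: eq_card => x; rewrite !inE; case: (p.2 x).
- move=> x ax; rewrite inE => nx; have [_] := moving_step vp ax nx.
  by rewrite /grid_step /left_step /down_step /time; lia.
- by move=> x z; rewrite /time => t1 c1; apply: grid_inj => //; lia.
- by move=> x z /tl t1; apply: exit_min t1.
- by move=> x z /tl t1; apply: entry_min t1.
- by move=> x z /tl t1 /tl t2; have [] := tele_time _ _ _ _ t1 t2.
by move=> x z /tl t1 /tl t2; have [] := tele_time _ _ _ _ t1 t2.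
Qed.
End GridSign.

Lemma det_choice M m tele free :
  (forall p, valid_choice (@grid_step M m) tele free p ->
     odd_perm p.1 = odd #|[set x | ~~ p.2 x && (p.1 x != x)]|) ->
  \det (\matrix_(x, z) choice_weight (@grid_step M m) tele free x z) =
  #|[set p | valid_choice (@grid_step M m) tele free p]|%:R.
Proof.
move=> sgn; rewrite -(sum_sign_choice_weight (@grid_step_irr M m) sgn).
by apply: eq_bigr => s _; congr (_ * _); apply: eq_bigr => x _; rewrite mxE.
Qed.

(** In the absence of teleports the sign argument shows that this determinant is a cardinal; being
    invertible over the integers, it is 1. *)
Lemma det_step_mx M m : \det (step_mx M m) = 1.
Proof.
have : \det (step_mx M m) =
    #|[set p | valid_choice (@grid_step M m) (fun _ _ => false) xpredT p]|%:R.
  rewrite -det_choice => [|p vp].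
    by congr (\det _); apply/matrixP=> x z; rewrite !mxE /choice_weight add0r mul1r.
  by apply: (@grid_valid_sign _ _ (fun _ _ => false) xpredT).
have := congr1 determinant (step_paths_mx M m); rewrite det_mulmx det1 => h e.
move: h; rewrite e => /(congr1 absz); rewrite abszM natz /= => /eqP.
by rewrite muln_eq1 => /andP[/eqP-> _].
Qed.

Section CSCount.
Variables m y : nat.
Notation T := 'I_#|{: 'I_(m + y) * 'I_m}|.

Let exit_col (i : 'I_m) : (0 < m + y)%N.
Proof. by have := ltn_ord i; lia. Qed.
Let exit_row (i : 'I_m) : (m.-1 - i < m)%N.
Proof. by have := ltn_ord i; lia. Qed.
Let entry_col (i : 'I_m) : (y + i < m + y)%N.
Proof. by have := ltn_ord i; lia. Qed.
Let entry_row (i : 'I_m) : (m.-1 < m)%N.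
Proof. by have := ltn_ord i; lia. Qed.

(** The left side, read downwards, is glued to the part of the top side from column [y] on; the
    first [y] columns of the top side border the hole. *)
Definition cs_exit i : T := point (exit_col i) (exit_row i).
Definition cs_entry i : T := point (entry_col i) (entry_row i).

Definition cs_choice := valid_choice (@grid_step (m + y) m) (teleport cs_exit cs_entry) xpredT.

Lemma cs_exit_inj : injective cs_exit.
Proof.
move=> i j /(congr1 (@grow _ _)); rewrite !grow_point => h; apply/val_inj.
by have := ltn_ord i; have := ltn_ord j; move: h => /=; lia.
Qed.

Lemma card_cs_choice : #|[set p | cs_choice p]|%:R = \det (cs_mx int y m).
Proof.
rewrite -det_choice => [|p vp].
  rewrite (det_optional_teleport _ cs_exit_inj (det_step_mx _ _)).
  congr (\det _); apply/matrixP=> i j; rewrite !mxE !gcol_point !grow_point; congr (_ + _%:R).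
  have := ltn_ord i; have := ltn_ord j => ltj lti; rewrite /npaths leq0n leq_subr /= subn0.
  have -> : (m.-1 - (m.-1 - j) = j)%N by lia.
  by rewrite -bin_sub ?leq_addr // addKn.
apply: grid_valid_sign vp _ _ _ => [x w z|x w z|x w x' w'].
- by case/existsP=> i /andP[/eqP-> _] _ _; rewrite gcol_point.
- case/existsP=> i /andP[_ /eqP->] _; rewrite /time gcol_point grow_point.
  by have := ltn_grow z; have := ltn_ord i; lia.
case/existsP=> i /andP[/eqP-> /eqP->] /existsP[j /andP[/eqP-> /eqP->]].
rewrite /time !gcol_point !grow_point; have := ltn_ord i; have := ltn_ord j; lia.
Qed.

(** The identity without teleports is the empty family of paths. This positivity later yields the
    nonvanishing of D_m. *)
Lemma cs_choice_gt0 : (0 < #|[set p | cs_choice p]|)%N.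
Proof.
apply/card_gt0P; exists (1%g, [ffun=> false]); rewrite inE; apply/forallP=> x /=.
by rewrite ffunE perm1 eqxx.
Qed.
End CSCount.

Local Close Scope ring_scope.

(** * Tilings invariant under a group of symmetries *)

Section Tilings.
Variable N : nat.
Implicit Types (c u v : cell N) (D B L : {set cell N}) (T : {set {set cell N}}).

Lemma share_edge_up u v : share_edge u v -> up u.
Proof. by case/and3P. Qed.

Lemma share_edge_down u v : share_edge u v -> down v.
Proof. by case/and3P. Qed.

Lemma up_not_down c : up c -> down c = false.
Proof. by rewrite /up /down => /eqP h; apply/negP => /eqP; lia. Qed.

Lemma mem_lozenge_up u v c : share_edge u v -> c \in [set u; v] -> up c -> c = u.
Proof.
move=> /share_edge_down dv; rewrite !inE => /orP[/eqP//|/eqP->] /up_not_down.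
by rewrite dv.
Qed.

Lemma mem_lozenge_down u v c : share_edge u v -> c \in [set u; v] -> down c -> c = v.
Proof.
move=> /share_edge_up uu; rewrite !inE => /orP[/eqP->|/eqP//].
by rewrite (up_not_down uu).
Qed.

Lemma lozengeP L : reflect (exists u v, share_edge u v /\ L = [set u; v]) (lozenge L).
Proof.
apply: (iffP existsP) => [[u /existsP[v /andP[e /eqP->]]]|[u [v [e ->]]]].
  by exists u, v.
by exists u; apply/existsP; exists v; rewrite e eqxx.
Qed.

Lemma lozenge_tilingP D T : lozenge_tiling D T <->
  [/\ forall B, B \in T -> lozenge B /\ B \subset D,
      forall c, c \in D -> exists2 B, B \in T & c \in B &
      forall B B' c, B \in T -> B' \in T -> c \in B -> c \in B' -> B = B'].
Proof.
rewrite /lozenge_tiling; split.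
  case/andP=> /and3P[/eqP cov triv n0] /forall_inP loz; split=> [B BT|c|B B' c BT B'T cB cB'].
  - by split; [exact: loz | rewrite -cov (bigcup_sup B)].
  - by rewrite -cov => /bigcupP[B BT cB]; exists B.
  by rewrite -(def_pblock triv BT cB) (def_pblock triv B'T cB').
case=> loz cov uniqB; apply/andP; split; last by apply/forall_inP=> B /loz[].
apply/and3P; split.
- rewrite eqEsubset; apply/andP; split; apply/subsetP=> c.
    by case/bigcupP=> B /loz[_ /subsetP]; apply.
  by case/cov=> B BT cB; apply/bigcupP; exists B.
- apply/trivIsetP=> B B' BT B'T; apply: contraR => /pred0Pn[c /andP[/= cB cB']].
  by apply/eqP; apply: uniqB cB cB'.
apply/negP=> /loz[/lozengeP[u [v [_ e]]] _].
by have := set21 u v; rewrite -e inE.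
Qed.

Lemma invariant_tilingP (f : cell N -> cell N) T : injective f ->
  reflect (forall B, B \in T -> f @: B \in T) (invariant_tiling f T).
Proof.
move=> f_inj; apply: (iffP eqP) => [e B BT|h].
  by have := imset_f (fun L => f @: L) BT; rewrite -/(tiling_image f T) e.
apply/eqP; rewrite eqEcard card_imset ?leqnn ?andbT; last exact: imset_inj.
by apply/subsetP=> _ /imsetP[B BT ->]; exact: h.
Qed.

Lemma tiling_sub_eq D T T' :
  lozenge_tiling D T -> lozenge_tiling D T' -> T \subset T' -> T = T'.
Proof.
move=> /lozenge_tilingP[loz cov _] /lozenge_tilingP[loz' _ uniqB] /subsetP sub.
apply/eqP; rewrite eqEsubset; apply/andP; split; apply/subsetP=> // B BT'.
have [/lozengeP[u [v [_ e]]] /subsetP BD] := loz' B BT'.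
have uB : u \in B by rewrite e set21.
have [B' B'T uB'] := cov u (BD _ uB).
by rewrite (uniqB B B' u) // sub.
Qed.
End Tilings.

(* [Fo] is a set of forced lozenges; off them the group acts freely, with representatives
   [uF x] (x in [XU]) for the up triangles and [dF z] (z in [ZD]) for the down triangles. *)
Section Quotient.
Variables (N : nat) (I T Pt : finType) (act : I -> cell N -> cell N).
Variables (H : {set cell N}) (Fo : {set {set cell N}}).
Let R := H :\: cover Fo.

Hypothesis act1 : exists e, forall c, act e c = c.
Hypothesis actM : forall g g', exists h, forall c, act h c = act g (act g' c).
Hypothesis actV : forall g, exists h,
  (forall c, act h (act g c) = c) /\ (forall c, act g (act h c) = c).
Hypothesis act_edge : forall g u v, share_edge u v -> share_edge (act g u) (act g v).
Hypothesis actH : forall g c, c \in H -> act g c \in H.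
Hypothesis H_cells : forall c, c \in H -> up c || down c.
Hypothesis Fo_loz : forall B, B \in Fo -> lozenge B /\ B \subset H.
Hypothesis Fo_triv : trivIset Fo.
Hypothesis Fo_act : forall g B, B \in Fo -> act g @: B \in Fo.
Hypothesis act_free : forall g g' c, c \in R -> act g c = act g' c -> g = g'.

Variables (uF dF : T -> cell N) (XU ZD : {set T}).
Hypothesis uF_R : forall x, x \in XU -> uF x \in R.
Hypothesis uF_up : forall x, x \in XU -> up (uF x).
Hypothesis dF_R : forall z, z \in ZD -> dF z \in R.
Hypothesis up_repr : forall c, c \in R -> up c ->
  exists g, exists2 x, x \in XU & c = act g (uF x).
Hypothesis down_repr : forall c, c \in R -> down c ->
  exists g, exists2 z, z \in ZD & c = act g (dF z).
Hypothesis uF_inj : forall g, {in XU &, forall x x', act g (uF x) = uF x' -> x = x'}.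
Hypothesis dF_inj : forall g, {in ZD &, forall x x', act g (dF x) = dF x' -> x = x'}.

Variables (valid : pred Pt) (sg : Pt -> T -> T) (nb : Pt -> T -> cell N).

(** The neighbour [v] is kept along with its class [z], since two neighbours of a triangle may
    belong to the same class. *)
Definition linked (x : T) (v : cell N) (z : T) :=
  [/\ share_edge (uF x) v, z \in ZD & exists g, v = act g (dF z)].

Hypothesis valid_linked : forall p x, valid p -> x \in XU -> linked x (nb p x) (sg p x).
Hypothesis valid_inj : forall p, valid p -> {in XU &, injective (sg p)}.
Hypothesis valid_surj : forall p z, valid p -> z \in ZD -> exists2 x, x \in XU & sg p x = z.
Hypothesis valid_ext : forall p p', valid p -> valid p' ->
  {in XU, nb p =1 nb p'} -> p = p'.
Hypothesis valid_real : forall phi zeta,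
  (forall x, x \in XU -> linked x (phi x) (zeta x)) -> {in XU &, injective zeta} ->
  exists2 p, valid p & {in XU, nb p =1 phi}.

Let act_inj g : injective (act g).
Proof. by have [h [hK _]] := actV g; exact: can_inj hK. Qed.

Let actR g c : c \in R -> act g c \in R.
Proof.
rewrite !inE => /andP[nc cH]; rewrite actH // andbT; apply: contra nc.
case/bigcupP=> B BF cB; have [h [hK _]] := actV g.
by apply/bigcupP; exists (act h @: B); [exact: Fo_act | rewrite -(hK c) imset_f].
Qed.

Let R_H c : c \in R -> c \in H.
Proof. by rewrite inE => /andP[]. Qed.

Let linked_R x v z : linked x v z -> v \in R.
Proof. by case=> _ zD [g ->]; exact/actR/dF_R. Qed.

Definition tile p (gx : I * T) := act gx.1 @: [set uF gx.2; nb p gx.2].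
Definition tiling_of p := Fo :|: [set tile p gx | gx in setX [set: I] XU].

Let tileE p g x : tile p (g, x) = [set act g (uF x); act g (nb p x)].
Proof. by rewrite /tile imsetU !imset_set1. Qed.

Let tile_in p g x : x \in XU -> tile p (g, x) \in tiling_of p.
Proof. by move=> xU; rewrite inE; apply/orP; right; apply: imset_f; rewrite !inE. Qed.

Let tilingP p B : B \in tiling_of p ->
  B \in Fo \/ exists g x, x \in XU /\ B = tile p (g, x).
Proof.
rewrite inE => /orP[->|/imsetP[[g x]]]; first by left.
by rewrite inE /= => /andP[_ xU] ->; right; exists g, x.
Qed.

Let tile_R p g x c : valid p -> x \in XU -> c \in tile p (g, x) -> c \in R.
Proof.
move=> vp xU; rewrite tileE !inE -!in_setD => /orP[]/eqP->; first exact/actR/uF_R.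
exact/actR/linked_R/(valid_linked vp xU).
Qed.

Let act_uF g g' x x' : x \in XU -> x' \in XU -> act g (uF x) = act g' (uF x') ->
  g = g' /\ x = x'.
Proof.
move=> xU x'U e; have [h [hK _]] := actV g'; have [k kE] := actM h g.
have xx' : x = x' by apply: (@uF_inj k) => //; rewrite kE e hK.
by split=> //; apply: act_free (uF_R xU) _; rewrite e xx'.
Qed.

Let act_dF g g' z z' : z \in ZD -> z' \in ZD -> act g (dF z) = act g' (dF z') -> z = z'.
Proof.
move=> zD z'D e; have [h [hK _]] := actV g'; have [k kE] := actM h g.
by apply: (@dF_inj k) => //; rewrite kE e hK.
Qed.

Let linked_class x v z x' v' z' g g' : linked x v z -> linked x' v' z' ->
  act g v = act g' v' -> z = z'.
Proof.
move=> [_ zD [h ->]] [_ z'D [h' ->]].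
have [k kE] := actM g h; have [k' kE'] := actM g' h'.
by rewrite -kE -kE'; exact: act_dF.
Qed.

(** Surjectivity of [sg p] makes the tiles cover. Two tiles with a common triangle have the same
    representative, by uniqueness or by injectivity of [sg p], and then the same group element, by
    freeness. *)
Lemma tiling_of_tiling p : valid p -> lozenge_tiling H (tiling_of p).
Proof.
move=> vp; apply/lozenge_tilingP; split.
- move=> B /tilingP[/Fo_loz//|[g [x [xU ->]]]].
  have [e _ _] := valid_linked vp xU; split.
    by apply/lozengeP; exists (act g (uF x)), (act g (nb p x)); rewrite tileE act_edge.
  by apply/subsetP=> c /(tile_R vp xU)/R_H.
- move=> c cH; have [/bigcupP[B BF cB]|nF] := boolP (c \in cover Fo).
    by exists B; rewrite // inE BF.
  have cR : c \in R by rewrite inE nF.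
  case/orP: (H_cells cH) => [uc|dc].
    have [g [x xU ->]] := up_repr cR uc.
    by exists (tile p (g, x)); [exact: tile_in | rewrite tileE set21].
  have [g [z zD ->]] := down_repr cR dc.
  have [x xU xz] := valid_surj vp zD.
  have [_ _ [h nbE]] := valid_linked vp xU.
  have [h' [h'K _]] := actV h; have [k kE] := actM g h'.
  exists (tile p (k, x)); first exact: tile_in.
  by rewrite tileE nbE xz !kE h'K set22.
move=> B B' c /tilingP[BF|[g [x [xU ->]]]] /tilingP[B'F|[g' [x' [x'U ->]]]] cB cB'.
- by rewrite -(def_pblock Fo_triv BF cB) (def_pblock Fo_triv B'F cB').
- have := tile_R vp x'U cB'; rewrite inE => /andP[/negP[]].
  by apply/bigcupP; exists B.
- have := tile_R vp xU cB; rewrite inE => /andP[/negP[]].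
  by apply/bigcupP; exists B'.
have lx := valid_linked vp xU; have lx' := valid_linked vp x'U.
have e : share_edge (act g (uF x)) (act g (nb p x)) by apply: act_edge; case: lx.
have e' : share_edge (act g' (uF x')) (act g' (nb p x')) by apply: act_edge; case: lx'.
move: (cB) (cB'); rewrite !tileE => cB1 cB1'.
case/orP: (H_cells (R_H (tile_R vp xU cB))) => hc.
  have h := mem_lozenge_up e cB1 hc; have h' := mem_lozenge_up e' cB1' hc.
  by have [-> ->] : g = g' /\ x = x' by apply: act_uF; rewrite // -h.
have h := mem_lozenge_down e cB1 hc; have h' := mem_lozenge_down e' cB1' hc.
have exx : x = x'.
  by apply: (valid_inj vp xU x'U); exact: linked_class lx lx' (etrans (esym h) h').
subst x'; have -> // : g = g'.
exact: act_free (linked_R lx) (etrans (esym h) h').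
Qed.

Lemma tiling_of_inj : {in valid &, injective tiling_of}.
Proof.
move=> p p' vp vp' e; apply: valid_ext => // x xU.
have [i iE] := act1.
have /lozenge_tilingP[_ _ uniqB] := tiling_of_tiling vp.
have [e1 _ _] := valid_linked vp xU; have [e2 _ _] := valid_linked vp' xU.
have b1 : [set uF x; nb p x] \in tiling_of p.
  by rewrite -(iE (uF x)) -(iE (nb p x)) -tileE tile_in.
have b2 : [set uF x; nb p' x] \in tiling_of p.
  by rewrite e -(iE (uF x)) -(iE (nb p' x)) -tileE tile_in.
have eB := uniqB _ _ (uF x) b1 b2 (set21 _ _) (set21 _ _).
have := set22 (uF x) (nb p x); rewrite eB => h.
exact: mem_lozenge_down e2 h (share_edge_down e1).
Qed.

Lemma tiling_of_invariant p g : invariant_tiling (act g) (tiling_of p).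
Proof.
apply/invariant_tilingP => [|B /tilingP[BF|[h [x [xU ->]]]]]; first exact: act_inj.
  by rewrite inE Fo_act.
have [k kE] := actM g h.
have -> : act g @: tile p (h, x) = tile p (k, x).
  by rewrite !tileE imsetU !imset_set1 !kE.
exact: tile_in.
Qed.

(** The partners [phi x] of the representatives determine [S]. If two partners lie in one class, a
    group element moves one to the other, hence tile to tile and [uF x] to [uF x']; so the classes
    [zeta x] are distinct. Finally, a tiling contained in another one equals it. *)
Lemma tiling_of_surj S : lozenge_tiling H S -> (forall g, invariant_tiling (act g) S) ->
  Fo \subset S -> exists2 p, valid p & S = tiling_of p.
Proof.
move=> tS invS FS; have /lozenge_tilingP[loz cov uniqB] := tS.
have actS g B : B \in S -> act g @: B \in S.
  by move/(invariant_tilingP _ (@act_inj g)): (invS g); apply.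
pose Phi x v := share_edge (uF x) v && ([set uF x; v] \in S).
have exPhi x : x \in XU -> exists v, Phi x v.
  move=> xU; have [B BS xB] := cov _ (R_H (uF_R xU)).
  have [/lozengeP[u [v [e eB]]] _] := loz B BS.
  rewrite eB in xB BS; have h := mem_lozenge_up e xB (uF_up xU).
  by exists v; rewrite /Phi h e.
have PhiR x v : x \in XU -> Phi x v -> v \in R.
  move=> xU /andP[e BS]; rewrite inE; apply/andP; split; last first.
    by have [_ /subsetP] := loz _ BS; apply; rewrite set22.
  apply/negP => /bigcupP[B BF vB].
  have eB := uniqB _ _ v BS (subsetP FS _ BF) (set22 _ _) vB.
  have := uF_R xU; rewrite inE => /andP[/negP[]].
  by apply/bigcupP; exists B; rewrite // -eB set21.
pose phi x := odflt (uF x) [pick v | Phi x v].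
have phiP x : x \in XU -> Phi x (phi x).
  move=> xU; rewrite /phi; case: pickP => //= h.
  by have [v] := exPhi x xU; rewrite h.
pose zeta x := odflt x [pick z in ZD | [exists g, phi x == act g (dF z)]].
have lk x : x \in XU -> linked x (phi x) (zeta x).
  move=> xU; have Px := phiP x xU; have /andP[e _] := Px.
  have vR := PhiR x _ xU Px.
  rewrite /linked e /zeta; case: pickP => [z /andP[zD /existsP[g /eqP gE]]|h] /=.
    by split=> //; exists g.
  have [g [z zD gE]] := down_repr vR (share_edge_down e).
  by have := h z; rewrite /= zD => /existsP[]; exists g; apply/eqP.
have zi : {in XU &, injective zeta}.
  move=> x x' xU x'U ez.
  have /andP[_ b] := phiP x xU; have /andP[_ b'] := phiP x' x'U.
  have [e _ [g gE]] := lk x xU; have [e' _ [g' gE']] := lk x' x'U.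
  have [h [hK _]] := actV g; have [k kE] := actM g' h.
  have eB := uniqB _ _ (phi x') (actS k _ b) b'.
  have kphi : act k (phi x) = phi x' by rewrite kE gE hK gE' ez.
  have := eB _ (set22 _ _); rewrite -{1}kphi imset_f ?set22 // => /(_ isT) eB'.
  have : act k (uF x) \in [set uF x'; phi x'] by rewrite -eB' imset_f ?set21.
  move=> h1; have := mem_lozenge_up e' h1; rewrite (share_edge_up (act_edge k e)) => /(_ isT).
  exact: uF_inj.
have [p vp pE] := valid_real lk zi; exists p => //.
apply/esym/(tiling_sub_eq (tiling_of_tiling vp) tS).
apply/subsetP=> B /tilingP[/(subsetP FS)//|[g [x [xU ->]]]].
by apply: actS; rewrite /= pE //; have /andP[] := phiP x xU.
Qed.

Lemma card_invariant_tilings :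
  #|[set S | [&& lozenge_tiling H S, [forall g, invariant_tiling (act g) S] & Fo \subset S]]|
  = #|[set p | valid p]|.
Proof.
rewrite -(card_in_imset (f := tiling_of)) => [|p p']; last first.
  by rewrite !inE; exact: tiling_of_inj.
apply: eq_card => S; apply/idP/imsetP.
  rewrite inE => /and3P[tS /forallP invS FS].
  by have [p vp ->] := tiling_of_surj tS invS FS; exists p; rewrite ?inE.
case=> p; rewrite inE => vp ->; rewrite inE tiling_of_tiling // subsetUl andbT /=.
by apply/forallP=> g; exact: tiling_of_invariant.
Qed.
End Quotient.

(** * Cyclically symmetric tilings *)

Section Symmetries.
Variable N : nat.
Implicit Types c u v : cell N.

Lemma cell_eq c c' : co1 c = co1 c' -> co2 c = co2 c' -> co3 c = co3 c' -> c = c'.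
Proof.
case: c c' => [[i j] k] [[i' j'] k']; rewrite /co1 /co2 /co3 /= => h1 h2 h3.
by congr (_, _, _); apply: val_inj.
Qed.

Definition rotn (g : nat) c := iter g (@rot120 N) c.

Lemma rot120K3 c : rot120 (rot120 (rot120 c)) = c.
Proof. by case: c => [[]]. Qed.

Lemma rotn_mod g c : rotn (g %% 3) c = rotn g c.
Proof.
rewrite [in RHS](divn_eq g 3) /rotn addnC iterD; congr iter.
by elim: (g %/ 3) => [|n IH] //; rewrite mulSn iterD -IH /= rot120K3.
Qed.

Lemma rotnD g g' c : rotn (g + g') c = rotn g (rotn g' c).
Proof. exact: iterD. Qed.

Lemma rotn_small (h : nat) : exists g : 'I_3, forall c, rotn g c = rotn h c.
Proof.
by exists (Ordinal (ltn_pmod h (isT : 0 < 3))) => c; exact: rotn_mod.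
Qed.

Lemma rotnV (g : 'I_3) c : rotn (g + g) (rotn g c) = c /\ rotn g (rotn (g + g) c) = c.
Proof.
rewrite -!rotnD -(rotn_mod (g + g + g)) -(rotn_mod (g + (g + g))).
by have [-> ->] : (g + g + g) %% 3 = 0 /\ (g + (g + g)) %% 3 = 0 by lia.
Qed.

Lemma share_edge_rot u v : share_edge u v -> share_edge (rot120 u) (rot120 v).
Proof. rewrite /share_edge /up /down /co1 /co2 /co3 /=; lia. Qed.

Lemma share_edge_rotn g u v : share_edge u v -> share_edge (rotn g u) (rotn g v).
Proof. by move=> h; elim: g => //= g; exact: share_edge_rot. Qed.

Lemma up_rotn g c : up c -> up (rotn g c).
Proof. by move=> h; elim: g => //= g; rewrite /up /co1 /co2 /co3 /=; lia. Qed.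

Lemma down_rotn g c : down c -> down (rotn g c).
Proof. by move=> h; elim: g => //= g; rewrite /down /co1 /co2 /co3 /=; lia. Qed.

Lemma share_edge_refl u v : share_edge u v -> share_edge (refl u) (refl v).
Proof. rewrite /share_edge /up /down /co1 /co2 /co3 /=; lia. Qed.

Lemma rotn_coords (g : 'I_3) c :
  [\/ [/\ g = 0 :> nat, co1 (rotn g c) = co1 c, co2 (rotn g c) = co2 c & co3 (rotn g c) = co3 c],
      [/\ g = 1 :> nat, co1 (rotn g c) = co2 c, co2 (rotn g c) = co3 c & co3 (rotn g c) = co1 c] |
      [/\ g = 2 :> nat, co1 (rotn g c) = co3 c, co2 (rotn g c) = co1 c & co3 (rotn g c) = co2 c]].
Proof. by case: g => [[|[|[|//]]] ?]; [apply: Or31 | apply: Or32 | apply: Or33]. Qed.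

End Symmetries.

(* The sector p >= m, r < m is a fundamental domain for the rotation.  The position (a, k) stands
   for the two triangles with p in [m+a, m+a+1] and r in [k, k+1]; a fixed position means that these
   two are joined, a left (down) step that the up triangle is joined to the down triangle across its
   side on p = const (r = const).  A teleport is a lozenge sticking out of the sector across p = m,
   rotated back along the side r = m. *)
Section Positions.
Variables m y : nat.
Notation T := 'I_#|{: 'I_(m + y) * 'I_m}|.
Notation N := (3 * m + y).
Notation H := (holed_hexagon m y).
Notation choice := ({perm T} * {ffun T -> bool})%type.
Implicit Types (x z : T) (p : choice).

Lemma hexagonE c : (c \in H) = [&& up c || down c,
   co1 c < 2 * m + y, co2 c < 2 * m + y, co3 c < 2 * m + y &
   ~~ [&& m <= co1 c, m <= co2 c & m <= co3 c]].
Proof. by rewrite inE. Qed.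

Lemma rot_hexagon c : c \in H -> rot120 c \in H.
Proof. rewrite !hexagonE /up /down /co1 /co2 /co3 /=; lia. Qed.

Lemma rotn_hexagon g c : c \in H -> rotn g c \in H.
Proof. by move=> h; elim: g => //= g; exact: rot_hexagon. Qed.

Lemma refl_hexagon c : c \in H -> refl c \in H.
Proof. rewrite !hexagonE /up /down /co1 /co2 /co3 /=; lia. Qed.

Let c1_lt x : m + gcol x < N.
Proof. have := ltn_gcol x; have := ltn_grow x; lia. Qed.
Let c2_lt x d : N - d.+1 - (m + gcol x) - grow x < N.
Proof. have := ltn_grow x; lia. Qed.
Let c3_lt x : grow x < N.
Proof. have := ltn_grow x; lia. Qed.

Definition ucell x : cell N := (Ordinal (c1_lt x), Ordinal (c2_lt x 0), Ordinal (c3_lt x)).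
Definition dcell x : cell N := (Ordinal (c1_lt x), Ordinal (c2_lt x 1), Ordinal (c3_lt x)).

Lemma ucellE x : [/\ co1 (ucell x) = m + gcol x, co2 (ucell x) = N - 1 - (m + gcol x) - grow x &
  co3 (ucell x) = grow x].
Proof. by []. Qed.

Lemma dcellE x : [/\ co1 (dcell x) = m + gcol x, co2 (dcell x) = N - 2 - (m + gcol x) - grow x &
  co3 (dcell x) = grow x].
Proof. by []. Qed.

Lemma ucell_up x : up (ucell x).
Proof.
have [e1 e2 e3] := ucellE x; rewrite /up e1 e2 e3.
have := ltn_gcol x; have := ltn_grow x; lia.
Qed.

Lemma dcell_down x : down (dcell x).
Proof.
have [e1 e2 e3] := dcellE x; rewrite /down e1 e2 e3.
have := ltn_gcol x; have := ltn_grow x; lia.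
Qed.

Lemma ucell_hexagon x : ucell x \in H.
Proof.
rewrite hexagonE ucell_up; have [-> -> ->] := ucellE x.
have := ltn_gcol x; have := ltn_grow x; lia.
Qed.

Lemma dcell_hexagon x : dcell x \in H.
Proof.
rewrite hexagonE dcell_down orbT; have [-> -> ->] := dcellE x.
have := ltn_gcol x; have := ltn_grow x; lia.
Qed.

Lemma ucell_of c : c \in H -> up c -> m <= co1 c -> co3 c < m -> exists x, c = ucell x.
Proof.
rewrite hexagonE => /and5P[_ h1 h2 h3 _] uc c1 c3.
have ha : co1 c - m < m + y by lia.
exists (point ha c3); apply: cell_eq; rewrite /co1 /co2 /co3 /= ?gcol_point ?grow_point.
- by move: c1; rewrite /co1; lia.
- by move: uc c1; rewrite /up /co1 /co2 /co3; lia.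
by [].
Qed.

Lemma dcell_of c : c \in H -> down c -> m <= co1 c -> co3 c < m -> exists x, c = dcell x.
Proof.
rewrite hexagonE => /and5P[_ h1 h2 h3 _] uc c1 c3.
have ha : co1 c - m < m + y by lia.
exists (point ha c3); apply: cell_eq; rewrite /co1 /co2 /co3 /= ?gcol_point ?grow_point.
- by move: c1; rewrite /co1; lia.
- by move: uc c1; rewrite /down /co1 /co2 /co3; lia.
by [].
Qed.

Definition predo n (i : 'I_n) : 'I_n := Ordinal (leq_ltn_trans (leq_pred i) (ltn_ord i)).

Definition next_cell (p : {perm T} * {ffun T -> bool}) x : cell N :=
  let c := ucell x in
  if (p.2 x) || (gcol (p.1 x) != gcol x) then (predo c.1.1, c.1.2, c.2)
  else if p.1 x == x then (c.1.1, predo c.1.2, c.2) else (c.1.1, c.1.2, predo c.2).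

Lemma down_eq (c c' : cell N) : down c -> down c' -> co1 c = co1 c' -> co3 c = co3 c' -> c = c'.
Proof. by rewrite /down => d d' e1 e3; apply: cell_eq => //; lia. Qed.

Lemma next_cell_step p x : ~~ p.2 x -> (p.1 x == x) || grid_step x (p.1 x) ->
  [/\ share_edge (ucell x) (next_cell p x), co1 (next_cell p x) = m + gcol (p.1 x) &
      co3 (next_cell p x) = grow (p.1 x)].
Proof.
move=> /negPf np; set z := p.1 x => h.
have := ltn_gcol x; have := ltn_grow x; have := ltn_gcol z; have := ltn_grow z.
rewrite /next_cell np -/z /=; case: eqVneq h => [->|nzx] /=.
  by rewrite eqxx /= /share_edge /up /down /co1 /co2 /co3 /=; split; lia.
rewrite /grid_step /left_step /down_step.
case: (eqVneq (gcol z) (gcol x)) => e /=; rewrite /share_edge /up /down /co1 /co2 /co3 /=; split; lia.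
Qed.

Lemma next_cell_tele p x : p.2 x ->
  share_edge (ucell x) (next_cell p x) /\
  [/\ co1 (next_cell p x) = (m + gcol x).-1, co2 (next_cell p x) = N - 1 - (m + gcol x) - grow x &
      co3 (next_cell p x) = grow x].
Proof.
rewrite /next_cell => -> /=; have := ltn_gcol x; have := ltn_grow x.
rewrite /share_edge /up /down /co1 /co2 /co3 /=; split; last split; lia.
Qed.

Lemma next_cell_dcell p x : ~~ p.2 x -> (p.1 x == x) || grid_step x (p.1 x) ->
  next_cell p x = dcell (p.1 x).
Proof.
move=> np h; have [e e1 e3] := next_cell_step np h.
by apply: down_eq => //; [exact: share_edge_down e | exact: dcell_down].
Qed.

Lemma share_edge_cases x v : share_edge (ucell x) v ->
  [\/ (co1 v).+1 = m + gcol x /\ co3 v = grow x,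
      co1 v = m + gcol x /\ co3 v = grow x |
      co1 v = m + gcol x /\ (co3 v).+1 = grow x].
Proof.
have := ltn_gcol x; have := ltn_grow x.
rewrite /share_edge /up /down; have [-> -> ->] := ucellE x => ? ? h.
have : [|| ((co1 v).+1 == m + gcol x) && (co3 v == grow x),
           (co1 v == m + gcol x) && (co3 v == grow x) |
           (co1 v == m + gcol x) && ((co3 v).+1 == grow x)] by lia.
by case/or3P=> /andP[/eqP ? /eqP ?]; [apply: Or31 | apply: Or32 | apply: Or33].
Qed.

Lemma share_edge_step x z : share_edge (ucell x) (dcell z) -> (z == x) || grid_step x z.
Proof.
move=> e; have [//|nz] := eqVneq z x; have [d1 _ d3] := dcellE z.
have := share_edge_cases e; rewrite d1 d3 /grid_step /left_step /down_step => sc.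
case: (eqVneq (gcol x) (gcol z)) sc => [c|c] sc.
  case: (eqVneq (grow x) (grow z)) => r; last by case: sc => -[]; lia.
  by case/eqP: nz; apply: grid_inj.
by case: sc => -[]; lia.
Qed.

End Positions.

Section CSTilings.
Variables m y : nat.
Notation T := 'I_#|{: 'I_(m + y) * 'I_m}|.
Notation N := (3 * m + y).
Notation H := (holed_hexagon m y).
Implicit Types x z : T.
Notation choice := ({perm T} * {ffun T -> bool})%type.

Let act (g : 'I_3) : cell N -> cell N := rotn g.

Definition cs_linked x v z := linked act (@ucell m y) (@dcell m y) setT x v z.

Lemma cs_next_linked (p : choice) x : cs_choice p -> cs_linked x (next_cell p x) (p.1 x).
Proof.
move=> /forallP/(_ x) vx; have [px|npx] := boolP (p.2 x); rewrite ?px ?(negPf npx) in vx.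
  have [e [e1 e2 e3]] := next_cell_tele px.
  case/existsP: vx => i /andP[/eqP ex /eqP ez].
  (* The triangle across [p = m] is [(m-1, m+y+i, m-1-i)], and the down triangle of the entry is
     [(m+y+i, m-1-i, m-1)]: two rotations take the second to the first. *)
  split=> //; exists (@Ordinal 3 2 isT).
  have := ltn_ord i => lti.
  move: e1 e2 e3; rewrite ez ex !gcol_point !grow_point => e1 e2 e3.
  have [] := dcellE (cs_entry y i); rewrite !gcol_point !grow_point => d1 d2 d3.
  apply: cell_eq; rewrite ?e1 ?e2 ?e3.
  - by rewrite -[RHS]/(co3 _) d3; lia.
  - by rewrite -[RHS]/(co1 _) d1; lia.
  by rewrite -[RHS]/(co2 _) d2; lia.
have [e _ _] := next_cell_step npx vx.
by split=> //; exists (@Ordinal 3 0 isT); rewrite next_cell_dcell.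
Qed.

(** A triangle fixed by a nontrivial rotation has three equal coordinates; they are then at least
    [m], which places it in the hole. *)
Lemma rotn_free (g g' : 'I_3) c : c \in H -> rotn g c = rotn g' c -> g = g'.
Proof.
move=> cH e; apply/val_inj => /=; move: cH; rewrite hexagonE /up /down.
have [] := rotn_coords g c => -[g0 e1 e2 e3]; rewrite e in e1 e2 e3;
have [] := rotn_coords g' c => -[g0' e1' e2' e3']; lia.
Qed.

Lemma sector_inj (g : 'I_3) (c c' : cell N) : m <= co1 c -> co3 c < m -> m <= co1 c' -> co3 c' < m ->
  rotn g c = c' -> c = c'.
Proof.
by move=> h1 h3 h1' h3' e; have [] := rotn_coords g c => -[_ e1 e2 e3];
  rewrite e in e1 e2 e3; [apply: cell_eq | lia | lia].
Qed.

Lemma sector_repr c : c \in H -> exists g : 'I_3, m <= co1 (rotn g c) /\ co3 (rotn g c) < m.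
Proof.
rewrite hexagonE /up /down => h.
have : [|| (m <= co1 c) && (co3 c < m), (m <= co2 c) && (co1 c < m) | (m <= co3 c) && (co2 c < m)].
  by lia.
by case/or3P=> /andP[? ?];
  [exists (@Ordinal 3 0 isT) | exists (@Ordinal 3 1 isT) | exists (@Ordinal 3 2 isT)].
Qed.

Lemma ucell_inj x x' : ucell x = ucell x' -> x = x'.
Proof.
move=> e; have [e1 _ e3] := ucellE x; have [e1' _ e3'] := ucellE x'.
by apply: grid_inj; move: e1 e3; rewrite e e1' e3'; lia.
Qed.

Lemma dcell_inj x x' : dcell x = dcell x' -> x = x'.
Proof.
move=> e; have [e1 _ e3] := dcellE x; have [e1' _ e3'] := dcellE x'.
by apply: grid_inj; move: e1 e3; rewrite e e1' e3'; lia.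
Qed.

(** The neighbour reveals the move: its first coordinate is [m - 1] for a teleport and at least [m]
    otherwise, when it is [dcell] of the target. *)
Lemma cs_choice_ext (p p' : choice) : cs_choice p -> cs_choice p' ->
  {in [set: T], next_cell p =1 next_cell p'} -> p = p'.
Proof.
move=> vp vp' e.
have h x : p.1 x = p'.1 x /\ p.2 x = p'.2 x.
  have := e x (in_setT _).
  have := forallP vp x; have := forallP vp' x.
  have [px|npx] := boolP (p.2 x); have [px'|npx'] := boolP (p'.2 x); rewrite /=.
  - case/existsP=> i /andP[/eqP ei /eqP->]; case/existsP=> j /andP[/eqP ej /eqP->].
    by move: ej; rewrite ei => /cs_exit_inj->.
  - move=> h' /existsP[i /andP[/eqP ei _]] e'; exfalso.
    have [_ [e1 _ _]] := next_cell_tele px; have [_ e1' _] := next_cell_step npx' h'.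
    by move: e1; rewrite e' e1' ei gcol_point; have := ltn_ord i; lia.
  - move=> /existsP[i /andP[/eqP ei _]] h' e'; exfalso.
    have [_ [e1 _ _]] := next_cell_tele px'; have [_ e1' _] := next_cell_step npx h'.
    by move: e1; rewrite -e' e1' ei gcol_point; have := ltn_ord i; lia.
  move=> h' h; rewrite !next_cell_dcell // => /dcell_inj.
  by [].
case: p p' h {vp vp' e} => s b [s' b'] /= h; congr (_, _).
  by apply/permP=> x; have [] := h x.
by apply/ffunP=> x; have [] := h x.
Qed.

Lemma cs_choice_real (phi : T -> cell N) (zeta : T -> T) :
  (forall x, x \in setT -> cs_linked x (phi x) (zeta x)) -> {in setT &, injective zeta} ->
  exists2 p : choice, cs_choice p & {in setT, next_cell p =1 phi}.
Proof.
move=> lk zi; have zinj : injective zeta by move=> x z; apply: zi; rewrite inE.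
(* A teleport is recognised by its partner lying across the side [p = m] of the sector. *)
pose b := [ffun x : T => (gcol x == 0) && ((co1 (phi x)).+1 == m)].
have spec x : if b x then teleport (@cs_exit m y) (@cs_entry m y) x (zeta x)
              else ((zeta x == x) || grid_step x (zeta x)) && (phi x == dcell (zeta x)).
  rewrite ffunE; have [e _ [g]] := lk x (in_setT _).
  have lc := ltn_gcol x; have lr := ltn_grow x.
  have lc' := ltn_gcol (zeta x); have lr' := ltn_grow (zeta x).
  move=> pE; have [d1 d2 d3] := dcellE (zeta x).
  have [u1 u2 u3] := ucellE x.
  have := rotn_coords g (dcell (zeta x)); rewrite -[rotn g _]/(act g _) -pE d1 d2 d3 => rc.
  have dn := share_edge_down e; have sc := share_edge_cases e.
  case: ifP => [/andP[/eqP c0 /eqP p1]|nb].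
    have lti : m.-1 - grow x < m by lia.
    apply/existsP; exists (Ordinal lti); apply/andP; split; apply/eqP.
      by apply: grid_inj; rewrite ?gcol_point ?grow_point /=; lia.
    apply: grid_inj; rewrite ?gcol_point ?grow_point /=;
    move: dn; rewrite /down; case: rc => -[_ r1 r2 r3]; case: sc => -[s1 s3]; lia.
  have g0 : co1 (phi x) = m + gcol (zeta x) /\ co3 (phi x) = grow (zeta x).
    by move: nb; case: rc => -[_ r1 r2 r3]; case: sc => -[s1 s3]; lia.
  case: g0 => g1 g3; apply/andP; split; last first.
    by apply/eqP/down_eq; rewrite ?dcell_down // g1 g3.
  have pE' : phi x = dcell (zeta x) by apply: down_eq; rewrite ?dcell_down // g1 g3.
  by apply: share_edge_step; rewrite -pE'.
pose p : choice := (perm zinj, b).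
have vp : cs_choice p.
  apply/forallP=> x; have := spec x; rewrite /= permE.
  by case: (b x) => // /andP[].
exists p => // x _; have := spec x; have vx := forallP vp x.
have [e _ [g pE]] := lk x (in_setT _).
case: ifP => [bx _|nbx /andP[h /eqP->]]; last first.
  by rewrite next_cell_dcell ?permE //= ?nbx // permE.
have [e' [e1 e2 e3]] := next_cell_tele (p := p) (x := x) bx.
move: bx; rewrite ffunE => /andP[/eqP c0 /eqP p1].
apply: down_eq (share_edge_down e') (share_edge_down e) _ _; first by rewrite e1; lia.
by rewrite e3; case: (share_edge_cases e) => -[s1 s3]; lia.
Qed.

End CSTilings.

(** The rotation acts freely on the whole region, so the set of forced lozenges is taken empty. *)
Lemma CS_card m y : CS m y = #|[set p | @cs_choice m y p]|.
Proof.
have c0 : cover (set0 : {set {set cell (3 * m + y)}}) = set0 by rewrite /cover big_set0.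
rewrite -(@card_invariant_tilings (3 * m + y) 'I_3 _ _ (fun g : 'I_3 => rotn g)
  (holed_hexagon m y) set0 _ _ _ _ _ _ _ _ _ _ (@ucell m y)
  (@dcell m y) setT setT _ _ _ _ _ _ _ (@cs_choice m y) (fun p x => p.1 x) (@next_cell m y)).
- apply: eq_card => S; rewrite !inE sub0set andbT; congr (_ && _).
  have inj1 : injective (@rot120 (3 * m + y)) by apply: (@can_inj _ _ _ (rotn 2)); exact: rot120K3.
  apply/idP/forallP => [/(invariant_tilingP _ inj1) inv g|/(_ (@Ordinal 3 1 isT))];
    last by move=> h; exact: h.
  apply/invariant_tilingP => [|B BS]; first by apply: (@can_inj _ _ _ (rotn (g + g))) => c; case: (rotnV g c).
  elim: (nat_of_ord g) => [|n IH]; first by rewrite (eq_imset (g := id)) ?imset_id.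
  rewrite (eq_imset (g := fun c => rot120 (rotn n c))) // (imset_comp (@rot120 _)); exact: inv.
- by exists ord0.
- by move=> g g'; have [h hE] := rotn_small (3 * m + y) (g + g'); exists h => c; rewrite hE rotnD.
- move=> g; have [h hE] := rotn_small (3 * m + y) (g + g); exists h.
  by split=> c; rewrite hE; have [] := rotnV g c.
- by move=> g u v; exact: share_edge_rotn.
- by move=> g c; exact: rotn_hexagon.
- by move=> c; rewrite hexagonE => /andP[].
- by move=> B; rewrite inE.
- by apply/trivIsetP=> B B'; rewrite inE.
- by move=> g B; rewrite inE.
- by rewrite c0 setD0 => g g' c; exact: rotn_free.
- by move=> x _; rewrite c0 setD0 ucell_hexagon.
- by move=> x _; exact: ucell_up.
- by move=> x _; rewrite c0 setD0 dcell_hexagon.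
- rewrite c0 setD0 => c cH uc; have [g [h1 h3]] := sector_repr cH.
  have [|x xE] := ucell_of (rotn_hexagon g cH) _ h1 h3.
    exact: up_rotn.
  have [h hE] := rotn_small (3 * m + y) (g + g); exists h; exists x => //.
  by rewrite hE -xE; have [] := rotnV g c.
- rewrite c0 setD0 => c cH dc; have [g [h1 h3]] := sector_repr cH.
  have [|x xE] := dcell_of (rotn_hexagon g cH) _ h1 h3.
    exact: down_rotn.
  have [h hE] := rotn_small (3 * m + y) (g + g); exists h; exists x => //.
  by rewrite hE -xE; have [] := rotnV g c.
- move=> g x x' _ _ e; apply: (@ucell_inj m y).
  have [e1 _ e3] := ucellE x; have [e1' _ e3'] := ucellE x'.
  by apply: sector_inj e => //; rewrite ?e1 ?e1' ?e3 ?e3' ?leq_addr ?ltn_grow.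
- move=> g x x' _ _ e; apply: (@dcell_inj m y).
  have [e1 _ e3] := dcellE x; have [e1' _ e3'] := dcellE x'.
  by apply: sector_inj e => //; rewrite ?e1 ?e1' ?e3 ?e3' ?leq_addr ?ltn_grow.
- by move=> p x vp _; exact: cs_next_linked.
- by move=> p vp x x' _ _; exact: perm_inj.
- by move=> p z vp _; exists ((p.1)^-1%g z); rewrite ?inE ?permKV.
- exact: cs_choice_ext.
exact: cs_choice_real.
Qed.

(** * Cyclically symmetric and transpose-complementary tilings *)

(* Only the sector p > q > r is left: paths go from the triangles touching the axis q = r to those
   touching p = q.  Sending the sinks back to the sources makes them cycles, and leaving all other
   positions of the rectangle free is harmless, since [moving_below] and [moving_above] confine the
   moving positions to the sector. *)
Section CSTCCount.
Variables n w : nat.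
Notation T := 'I_#|{: 'I_(2 * n + 2 * w) * 'I_(2 * n)}|.
Notation choice := ({perm T} * {ffun T -> bool})%type.
Implicit Types (x z : T) (p : choice).

Let exit_col (e : 'I_n) : w + e < 2 * n + 2 * w.
Proof. by have := ltn_ord e; lia. Qed.
Let exit_row (e : 'I_n) : 2 * n - 1 - 2 * e < 2 * n.
Proof. by have := ltn_ord e; lia. Qed.
Let entry_col (e : 'I_n) : 2 * w + 2 * e < 2 * n + 2 * w.
Proof. by have := ltn_ord e; lia. Qed.
Let entry_row (e : 'I_n) : 2 * n - 1 - e < 2 * n.
Proof. by have := ltn_ord e; lia. Qed.

(** The up triangle of a sink is bisected by the axis [p = q], the down triangle of a source by the
    axis [q = r]. The teleports stand in for these, completing a matching inside the sector to a
    permutation. For [w = 0] the sink and the source of index 0 coincide. *)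
Definition cstc_sink e : T := point (exit_col e) (exit_row e).
Definition cstc_source e : T := point (entry_col e) (entry_row e).

Definition cstc_choice := valid_choice (@grid_step (2 * n + 2 * w) (2 * n))
  (teleport cstc_sink cstc_source) (predC (is_exit cstc_sink)).

Lemma cstc_sink_inj : injective cstc_sink.
Proof.
move=> i j /(congr1 (@gcol _ _)); rewrite !gcol_point => h; apply/val_inj.
by move: h => /=; lia.
Qed.

Lemma is_exitE x : is_exit cstc_sink x = (2 * gcol x + grow x + 1 == 2 * n + 2 * w).
Proof.
apply/existsP/eqP => [[e /eqP->]|h].
  by rewrite gcol_point grow_point; have := ltn_ord e; lia.
have lr := ltn_grow x; have lte : gcol x - w < n by lia.
exists (Ordinal lte); apply/eqP/grid_inj; rewrite ?gcol_point ?grow_point /=; lia.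
Qed.

Lemma teleport_is_exit x z : teleport cstc_sink cstc_source x z -> is_exit cstc_sink x.
Proof. by case/existsP=> e /andP[xe _]; apply/existsP; exists e. Qed.

Lemma moving_perm p x : (p.1 x \in moving p) = (x \in moving p).
Proof. exact: active_s. Qed.

(** Followed forwards, a moving position reaches a sink, and [2 * gcol + grow] decreases on the way;
    the sinks lie on the bounding line. *)
Lemma moving_below p x : cstc_choice p -> x \in moving p ->
  2 * n + 2 * w <= 2 * gcol x + grow x + 1.
Proof.
move=> vp mx; have [|nx] := boolP (is_exit cstc_sink x); first by rewrite is_exitE; lia.
move tx : (time x) => t; elim: t x tx mx nx => [|t IH] x tx mx nx;
  have npx : ~~ p.2 x by apply: contra nx => /(valid_tele vp)/teleport_is_exit.
  have [_] := moving_step vp mx npx.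
  by move: tx; rewrite /grid_step /left_step /down_step /time; lia.
have [_ st] := moving_step vp mx npx.
have := IH (p.1 x); rewrite moving_perm; move: st; move: (p.1 x) => z st IHz.
have [|nz] := boolP (is_exit cstc_sink z).
  by move: st; rewrite is_exitE /grid_step /left_step /down_step; lia.
have := IHz _ mx nz.
move: tx st; rewrite /time /grid_step /left_step /down_step; lia.
Qed.

(** The same argument backwards: the time increases until a source is met, and the sources lie on
    the bounding line. *)
Lemma moving_above p x : cstc_choice p -> x \in moving p ->
  gcol x + 2 * grow x + 2 <= 4 * n + 2 * w.
Proof.
move=> vp; move tx : (4 * n + 2 * w - time x) => t; elim: t x tx => [|t IH] x tx mx;
  have lc := ltn_gcol x; have lr := ltn_grow x; first by move: tx; rewrite /time; lia.
have [u ux] : exists u, p.1 u = x by exists ((p.1^-1)%g x); rewrite permKV.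
have mu : u \in moving p by rewrite -moving_perm ux.
have [pu|npu] := boolP (p.2 u).
  have := valid_tele vp pu; rewrite ux => /existsP[e /andP[_ /eqP->]].
  by rewrite gcol_point grow_point; have := ltn_ord e; lia.
have [_] := moving_step vp mu npu; rewrite ux => st.
have := IH u _ mu; move: tx st; rewrite /time /grid_step /left_step /down_step.
by have := ltn_gcol u; have := ltn_grow u; lia.
Qed.

(** At a fixed time, [moving_below] and [moving_above] become lower bounds for the column, attained
    at the sinks and at the sources respectively; this is the minimality required by the sign
    argument. *)
Lemma card_cstc_choice : (#|[set p | cstc_choice p]|%:R = \det (cstc_mx int w n))%R.
Proof.
rewrite -det_choice => [|p vp].
  rewrite (det_forced_teleport _ cstc_sink_inj (det_step_mx _ _)).
  congr (\det _)%R; apply/matrixP=> i j; rewrite !mxE !gcol_point !grow_point; congr (_%:R)%R.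
  have := ltn_ord i; have := ltn_ord j => ltj lti; rewrite /npaths /cstc_entry.
  have -> : (w + j <= 2 * w + 2 * i) = (j <= w + (i + i)) by lia.
  case: leqP => //= h1.
  have -> : (2 * n - 1 - 2 * j <= 2 * n - 1 - i) = (i <= 2 * j) by lia.
  case: leqP => h2; last by rewrite bin_small //; lia.
  congr binomial; lia.
apply: (grid_valid_sign vp) => [x u z|x u z|x u x' u'].
- case/existsP=> e /andP[/eqP-> _] mz; have := moving_below vp mz.
  by rewrite /time !gcol_point !grow_point; have := ltn_ord e; lia.
- case/existsP=> e /andP[_ /eqP->] mz; have := moving_above vp mz.
  by rewrite /time !gcol_point !grow_point; have := ltn_ord e; lia.
case/existsP=> i /andP[/eqP-> /eqP->] /existsP[j /andP[/eqP-> /eqP->]].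
rewrite /time !gcol_point !grow_point; have := ltn_ord i; have := ltn_ord j; lia.
Qed.
End CSTCCount.

(** * The dihedral group of order 6 acting on triangles *)

Section Dihedral.
Variable N : nat.
Implicit Types (c u v : cell N) (g : bool * 'I_3).

Definition dih g c : cell N := rotn g.2 (if g.1 then refl c else c).

Lemma reflK c : refl (refl c) = c.
Proof. by case: c => [[]]. Qed.

(** Conjugation by the reflection inverts the rotation, and the inverse of [rotn k] is
    [rotn (k + k)] as the rotation has order 3. *)
Lemma refl_rotn k c : refl (rotn k c) = rotn (k + k) (refl c).
Proof.
elim: k => [|k IH] //; rewrite addSn addnS.
have -> : rotn (k + k).+2 (refl c) = rot120 (rot120 (refl (rotn k c))) by rewrite IH.
by rewrite /rotn /=; case: (iter k _ c) => [[]].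
Qed.

Lemma dih_of (b : bool) k : exists g, forall c, dih g c = rotn k (if b then refl c else c).
Proof. by have [h hE] := rotn_small N k; exists (b, h) => c; rewrite /dih hE. Qed.

Lemma dihM g g' : exists h, forall c, dih h c = dih g (dih g' c).
Proof.
case: g g' => [[] i] [b' i'].
  have [h hE] := dih_of (~~ b') (i + (i' + i')); exists h => c.
  by rewrite hE /dih /= refl_rotn rotnD; case: (b') => //=; rewrite reflK.
have [h hE] := dih_of b' (i + i'); exists h => c.
by rewrite hE /dih /= rotnD.
Qed.

Lemma dihV g : exists h, (forall c, dih h (dih g c) = c) /\ (forall c, dih g (dih h c) = c).
Proof.
case: g => [[] i].
  exists (true, i); split=> c; rewrite /dih /= refl_rotn reflK;
  by have [] := rotnV i c.
have [h hE] := dih_of false (i + i); exists h.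
by split=> c; rewrite hE /dih /=; have [] := rotnV i c.
Qed.

Lemma dih_edge g u v : share_edge u v -> share_edge (dih g u) (dih g v).
Proof.
by move=> h; apply: share_edge_rotn; case: g.1 => //; exact: share_edge_refl.
Qed.

Lemma dih_up g c : up c -> up (dih g c).
Proof.
move=> h; apply: up_rotn; case: g.1 => //.
by move: h; rewrite /up /co1 /co2 /co3 /=; lia.
Qed.

Lemma dih_down g c : down c -> down (dih g c).
Proof.
move=> h; apply: down_rotn; case: g.1 => //.
by move: h; rewrite /down /co1 /co2 /co3 /=; lia.
Qed.

(** The group permutes the coordinates. A triangle is bisected by an axis exactly when two of them
    coincide, and [chamber] is the open sector between the axes [p = q] and [q = r]. *)
Definition distinct c := [&& co1 c != co2 c, co2 c != co3 c & co1 c != co3 c].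
Definition chamber c := (co3 c < co2 c) && (co2 c < co1 c).

Lemma chamber_distinct c : chamber c -> distinct c.
Proof. rewrite /chamber /distinct; lia. Qed.

Definition diagonal c := (co1 c == co2 c) && (co2 c == co3 c).

Lemma rotn_distinct k c : distinct (rotn k c) = distinct c.
Proof. by elim: k => //= k <-; rewrite /distinct /co1 /co2 /co3 /=; lia. Qed.

Lemma rotn_diagonal k c : diagonal (rotn k c) = diagonal c.
Proof. by elim: k => //= k <-; rewrite /diagonal /co1 /co2 /co3 /=; lia. Qed.

Lemma dih_distinct g c : distinct (dih g c) = distinct c.
Proof.
rewrite /dih rotn_distinct; case: g.1 => //.
by rewrite /distinct /co1 /co2 /co3 /=; lia.
Qed.

Lemma chamber_repr c : distinct c -> exists g, chamber (dih g c).
Proof.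
move=> dc; have : [|| chamber (dih (false, @Ordinal 3 0 isT) c),
   chamber (dih (false, @Ordinal 3 1 isT) c), chamber (dih (false, @Ordinal 3 2 isT) c),
   chamber (dih (true, @Ordinal 3 0 isT) c), chamber (dih (true, @Ordinal 3 1 isT) c) |
   chamber (dih (true, @Ordinal 3 2 isT) c)].
  by move: dc; rewrite /distinct /chamber /dih /= /co1 /co2 /co3 /=; lia.
by case/or4P => [h|h|h|/or3P[h|h|h]]; eexists; exact: h.
Qed.

Lemma chamber_dih g c : chamber c -> chamber (dih g c) -> dih g c = c.
Proof.
rewrite /dih => h; have [] := rotn_coords g.2 (if g.1 then refl c else c) => -[_];
move=> e1 e2 e3; rewrite /chamber e2 e3 e1 => h';
move: h h'; rewrite /chamber; case: (g.1) in e1 e2 e3 *; rewrite /co1 /co2 /co3 /= in e1 e2 e3 * => h h';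
by try (exfalso; lia); apply: cell_eq.
Qed.

(* The partner of a triangle bisected by an axis in every reflection-invariant tiling. *)
Definition mate c : cell N :=
  if co1 c == co2 c then (c.1.1, c.1.2, predo c.2)
  else if co2 c == co3 c then (predo c.1.1, c.1.2, c.2)
  else (c.1.1, predo c.1.2, c.2).

(** Under these hypotheses exactly one pair of coordinates coincides, so the outcome of the tests in
    [mate] is independent of their order. *)
Lemma mate_dih g c : ~~ distinct c -> ~~ diagonal c ->
  mate (dih g c) = dih g (mate c).
Proof.
move=> nd ne.
have mate_rot c' : ~~ distinct c' -> ~~ diagonal c' ->
    mate (rot120 c') = rot120 (mate c').
  rewrite /distinct /diagonal /mate /co1 /co2 /co3 /=.
  by do ?[case: ifP => ? //=]; lia.
have mate_refl c' : ~~ distinct c' -> ~~ diagonal c' ->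
    mate (refl c') = refl (mate c').
  rewrite /distinct /diagonal /mate /co1 /co2 /co3 /=.
  by do ?[case: ifP => ? //=]; lia.
rewrite /dih; set c' := if g.1 then refl c else c.
have nd' : ~~ distinct c' by rewrite -(dih_distinct g) /dih rotn_distinct in nd.
have ne' : ~~ diagonal c'.
  by rewrite /c'; case: (g.1) => //; move: ne; rewrite /diagonal /co1 /co2 /co3 /=; lia.
have -> : (if g.1 then refl (mate c) else mate c) = mate c'.
  by rewrite /c'; case: (g.1) => //; rewrite mate_refl.
elim: (nat_of_ord g.2) => [|k IH] //.
have -> : rotn k.+1 (mate c') = rot120 (rotn k (mate c')) by [].
by rewrite -IH -mate_rot // ?rotn_distinct ?rotn_diagonal.
Qed.

End Dihedral.

Section CSTCTilings.
Variables n w : nat.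
Notation T := 'I_#|{: 'I_(2 * n + 2 * w) * 'I_(2 * n)}|.
Notation N := (3 * (2 * n) + 2 * w).
Notation H := (holed_hexagon (2 * n) (2 * w)).
Notation choice := ({perm T} * {ffun T -> bool})%type.
Implicit Types (x z : T) (p : choice) (c u v : cell N) (g : bool * 'I_3).

Lemma dih_hexagon g c : c \in H -> dih g c \in H.
Proof. by move=> h; apply: rotn_hexagon; case: g.1 => //; exact: refl_hexagon. Qed.

Lemma hexagon_diagonal c : c \in H -> ~~ diagonal c.
Proof. rewrite hexagonE /up /down /diagonal; lia. Qed.

Definition on_axis u := [&& u \in H, up u & ~~ distinct u].

(** [N] is even, so the third coordinate of an up triangle with two equal ones is odd. Hence it is
    positive and the mate exists. *)
Lemma mate_spec u : on_axis u ->
  [/\ share_edge u (mate u), mate u \in H & ~~ distinct (mate u)].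
Proof.
rewrite /on_axis !hexagonE /distinct /mate => h.
case: ifP => [e1|e1].
  by move: h e1; rewrite /share_edge /up /down /co1 /co2 /co3 /=; split; lia.
case: ifP => [e2|e2].
  by move: h e1 e2; rewrite /share_edge /up /down /co1 /co2 /co3 /=; split; lia.
by move: h e1 e2; rewrite /share_edge /up /down /co1 /co2 /co3 /=; split; lia.
Qed.

Lemma mate_inj u u' : on_axis u -> on_axis u' -> mate u = mate u' -> u = u'.
Proof.
move=> ua ua' e; have [/share_edge_down dm mH _] := mate_spec ua; have nm := hexagon_diagonal mH.
have [/share_edge_down dm' _ _] := mate_spec ua'.
move: ua ua' => /and3P[_ uu ud] /and3P[_ uu' ud'].
have h1 := congr1 (@co1 _) e; have h2 := congr1 (@co2 _) e; have h3 := congr1 (@co3 _) e.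
apply: cell_eq; move: nm uu ud uu' ud' dm dm' h1 h2 h3;
  rewrite /up /down /distinct /diagonal /mate /co1 /co2 /co3; do ?[case: ifP => ? /=]; lia.
Qed.

(** Parity again: the third coordinate of [v] is even and all the bounds are even, so raising it by
    one neither leaves the hexagon nor enters the hole. *)
Lemma mate_surj v : v \in H -> down v -> ~~ distinct v -> exists2 u, on_axis u & v = mate u.
Proof.
rewrite hexagonE /distinct /down => h d nd.
have [e|ne] := eqVneq (co1 v) (co2 v).
  have lt : (co3 v).+1 < N by lia.
  exists (v.1.1, v.1.2, Ordinal lt).
    by move: h d nd e; rewrite /on_axis hexagonE /distinct /up /co1 /co2 /co3 /=; lia.
  by rewrite /mate -[co1 _]/(co1 v) -[co2 _]/(co2 v) e eqxx; apply: cell_eq.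
have [e|ne'] := eqVneq (co2 v) (co3 v).
  have lt : (co1 v).+1 < N by lia.
  exists (Ordinal lt, v.1.2, v.2).
    by move: h d nd e; rewrite /on_axis hexagonE /distinct /up /co1 /co2 /co3 /=; lia.
  rewrite /mate -[co1 _]/(co1 v).+1 -[co2 _]/(co2 v) -[co3 _]/(co3 v) e eqxx.
  by rewrite (_ : _ == _ = false); [apply: cell_eq | lia].
have lt : (co2 v).+1 < N by lia.
exists (v.1.1, Ordinal lt, v.2).
  by move: h d nd ne ne'; rewrite /on_axis hexagonE /distinct /up /co1 /co2 /co3 /=; lia.
rewrite /mate -[co1 _]/(co1 v) -[co2 _]/(co2 v).+1 -[co3 _]/(co3 v).
by do 2 (rewrite (_ : _ == _ = false); last by lia); apply: cell_eq.
Qed.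

Definition axis_lozenges : {set {set cell N}} := [set [set u; mate u] | u in on_axis].

Lemma cover_axis c : (c \in cover axis_lozenges) = (c \in H) && ~~ distinct c.
Proof.
apply/bigcupP/andP => [[B /imsetP[u ua ->]]|[cH nd]].
  have [e mH md] := mate_spec ua; move: ua; rewrite /on_axis => /and3P[uH _ ud].
  by case/set2P => ->.
have : up c || down c by move: cH; rewrite hexagonE => /andP[].
case/orP=> hc.
  exists [set c; mate c]; last exact: set21.
  by apply: imset_f; rewrite /on_axis -topredE /= cH hc nd.
have [u ua ->] := mate_surj cH hc nd.
by exists [set u; mate u]; [exact: imset_f | exact: set22].
Qed.

Lemma off_axis c : (c \in H :\: cover axis_lozenges) = (c \in H) && distinct c.
Proof. by rewrite inE cover_axis; case: (c \in H); rewrite ?andbF ?andbT ?negbK. Qed.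

Lemma trivIset_axis : trivIset axis_lozenges.
Proof.
apply/trivIsetP=> _ _ /imsetP[u ua ->] /imsetP[u' ua' ->]; apply: contraR.
case/pred0Pn=> c /andP[/= cu cu'].
have [e _ _] := mate_spec ua; have [e' _ _] := mate_spec ua'.
have : up c || down c.
  by case/set2P: cu => ->; rewrite ?(share_edge_up e) ?(share_edge_down e) ?orbT.
case/orP=> hc.
  by rewrite -(mem_lozenge_up e cu hc) -(mem_lozenge_up e' cu' hc).
by rewrite (mate_inj ua ua') // -(mem_lozenge_down e cu hc) -(mem_lozenge_down e' cu' hc).
Qed.

Lemma dih_axis g B : B \in axis_lozenges -> dih g @: B \in axis_lozenges.
Proof.
case/imsetP=> u ua ->; rewrite imsetU !imset_set1.
move: (ua); rewrite -topredE /= => /and3P[uH uu ud].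
rewrite -mate_dih ?hexagon_diagonal //; apply: imset_f.
by rewrite -topredE /= /on_axis dih_hexagon // dih_up // dih_distinct.
Qed.

Lemma dih_free g g' c : c \in H -> distinct c -> dih g c = dih g' c -> g = g'.
Proof.
case: g g' => [b i] [b' i'] cH dc; have [<-|nb] := eqVneq b b'.
  by move/rotn_free => /= -> //; case: b => //; exact: refl_hexagon.
rewrite /dih /= => e; exfalso; move: dc; rewrite /distinct.
have [] := rotn_coords i (if b then refl c else c) => -[_ e1 e2 e3]; rewrite e in e1 e2 e3;
have [] := rotn_coords i' (if b' then refl c else c) => -[_ e1' e2' e3'];
move: e1 e2 e3 e1' e2' e3' nb; case: (b); case: (b') => //; rewrite /co1 /co2 /co3 /=; lia.
Qed.

Definition chamber_up : {set T} := [set x | chamber (ucell x)].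
Definition chamber_down : {set T} := [set x | chamber (dcell x)].

Lemma chamber_upE x : (x \in chamber_up) =
  (2 * n + 2 * w <= 2 * gcol x + grow x) && (gcol x + 2 * grow x + 2 <= 4 * n + 2 * w).
Proof.
rewrite inE /chamber; have [-> -> ->] := ucellE x.
by have := ltn_gcol x; have := ltn_grow x; lia.
Qed.

Lemma chamber_downE x : (x \in chamber_down) =
  (2 * n + 2 * w <= 2 * gcol x + grow x + 1) && (gcol x + 2 * grow x + 3 <= 4 * n + 2 * w).
Proof.
rewrite inE /chamber; have [-> -> ->] := dcellE x.
by have := ltn_gcol x; have := ltn_grow x; lia.
Qed.

Lemma chamber_sector c : c \in H -> chamber c -> 2 * n <= co1 c /\ co3 c < 2 * n.
Proof. rewrite hexagonE /up /down /chamber; lia. Qed.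

Lemma sink_not_chamber x : is_exit (@cstc_sink n w) x -> x \notin chamber_up.
Proof. rewrite is_exitE chamber_upE; lia. Qed.

Lemma moving_chamber p x : cstc_choice p -> x \in moving p ->
  ~~ is_exit (@cstc_sink n w) x -> x \in chamber_up.
Proof.
move=> vp mx nx; have := moving_below vp mx; have := moving_above vp mx.
by rewrite chamber_upE; move: nx; rewrite is_exitE; lia.
Qed.

Lemma source_not_chamber e : @cstc_source n w e \notin chamber_down.
Proof. by rewrite chamber_downE gcol_point grow_point; have := ltn_ord e; lia. Qed.

Lemma chamber_down_up x : x \in chamber_down -> ~~ is_exit (@cstc_sink n w) x -> x \in chamber_up.
Proof. rewrite is_exitE chamber_upE chamber_downE; lia. Qed.

Lemma chamber_up_down x : x \in chamber_up ->
  x \in chamber_down \/ exists e, x = @cstc_source n w e.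
Proof.
move=> xu; have [|nd] := boolP (x \in chamber_down); [by left | right].
have lc := ltn_gcol x; have lr := ltn_grow x.
have lte : 2 * n - 1 - grow x < n.
  by move: xu nd; rewrite chamber_upE chamber_downE; lia.
exists (Ordinal lte); move: xu nd; rewrite chamber_upE chamber_downE => h1 h2.
apply: grid_inj; rewrite ?gcol_point ?grow_point /=; lia.
Qed.
End CSTCTilings.

Section CSTCTilings2.
Variables n w : nat.
Notation T := 'I_#|{: 'I_(2 * n + 2 * w) * 'I_(2 * n)}|.
Notation N := (3 * (2 * n) + 2 * w).
Notation H := (holed_hexagon (2 * n) (2 * w)).
Notation choice := ({perm T} * {ffun T -> bool})%type.
Implicit Types (x z : T) (p : choice) (c u v : cell N) (g : bool * 'I_3).

(** The reflection in the axis bisecting [u] exchanges two of its neighbours and fixes the third,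
    its mate. *)
Lemma mirror u : ~~ distinct u -> exists g, dih g u = u /\
  forall v, share_edge u v -> dih g v = v -> ~~ diagonal v -> v = mate u.
Proof.
move=> nd; have : [|| co1 u == co2 u, co2 u == co3 u | co1 u == co3 u].
  by move: nd; rewrite /distinct; lia.
rewrite /mate; case: eqVneq => [e _|n1 /=].
  exists (true, @Ordinal 3 0 isT); split.
    by apply: cell_eq; rewrite /dih /co1 /co2 /co3 /=; move: e; rewrite /co1 /co2.
  move=> v uv ev; have := congr1 (@co1 _) ev; move: e uv.
  rewrite /share_edge /up /down /diagonal /dih /co1 /co2 /co3 /= => e uv ev' dv.
  by apply: cell_eq; rewrite /co1 /co2 /co3 /=; lia.
case: eqVneq => [e _|n2 /= /eqP e].
  exists (true, @Ordinal 3 1 isT); split.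
    by apply: cell_eq; rewrite /dih /co1 /co2 /co3 /=; move: e; rewrite /co2 /co3.
  move=> v uv ev; have := congr1 (@co2 _) ev; move: e uv.
  rewrite /share_edge /up /down /diagonal /dih /co1 /co2 /co3 /= => e uv ev' dv.
  by apply: cell_eq; rewrite /co1 /co2 /co3 /=; lia.
exists (true, @Ordinal 3 2 isT); split.
  by apply: cell_eq; rewrite /dih /co1 /co2 /co3 /=; move: e; rewrite /co1 /co3.
move=> v uv ev; have := congr1 (@co1 _) ev; move: e uv.
rewrite /share_edge /up /down /diagonal /dih /co1 /co2 /co3 /= => e uv ev' dv.
by apply: cell_eq; rewrite /co1 /co2 /co3 /=; lia.
Qed.

(** The mirror of [u] sends its tile to a tile that also contains [u], hence to itself; the partner
    of [u] is therefore fixed by the mirror. *)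
Lemma axis_forced (S : {set {set cell N}}) : lozenge_tiling H S ->
  (forall g B, B \in S -> dih g @: B \in S) -> axis_lozenges n w \subset S.
Proof.
case/lozenge_tilingP=> loz cov uniqB inv; apply/subsetP=> _ /imsetP[u ua ->].
move: ua => /and3P[uH uu ud].
have [B BS uB] := cov u uH; have [/lozengeP[a [v [e eB]]] /subsetP BH] := loz B BS.
rewrite eB in uB BS BH; have ua := mem_lozenge_up e uB uu; rewrite -{a}ua in e eB uB BS BH.
have [g [gu gv]] := mirror ud.
have iS := inv g _ BS.
have eI : dih g @: [set u; v] = [set u; v].
  by apply: (uniqB _ _ u iS BS); rewrite ?set21 // -{1}gu imset_f ?set21.
have vv : dih g v = v.
  apply: (mem_lozenge_down e); first by rewrite -eI imset_f ?set22.
  exact/dih_down/(share_edge_down e).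
rewrite -(gv v e vv) //; exact/hexagon_diagonal/BH/set22.
Qed.

Definition cstc_linked x v z :=
  linked (fun g => @dih N g) (@ucell (2 * n) (2 * w)) (@dcell (2 * n) (2 * w)) (chamber_down n w) x v z.

Lemma cstc_step p x : cstc_choice p -> x \in chamber_up n w ->
  ~~ p.2 x /\ (p.1 x == x) || grid_step x (p.1 x).
Proof.
move=> vp xu; have nx : ~~ is_exit (@cstc_sink n w) x.
  by apply: contraL xu; exact: sink_not_chamber.
have np : ~~ p.2 x by apply: contra nx => /(valid_tele vp)/teleport_is_exit.
by split=> //; move/forallP/(_ x): vp; rewrite (negPf np) => /andP[].
Qed.

Lemma cstc_fixed p x : cstc_choice p -> x \notin chamber_up n w ->
  ~~ is_exit (@cstc_sink n w) x -> ~~ p.2 x /\ p.1 x = x.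
Proof.
move=> vp xu nx; have np : ~~ p.2 x by apply: contra nx => /(valid_tele vp)/teleport_is_exit.
split=> //; apply/eqP; apply: contraNT xu => px.
by apply: (moving_chamber vp) => //; rewrite !inE px orbT.
Qed.

Lemma cstc_next_linked p x : cstc_choice p -> x \in chamber_up n w ->
  cstc_linked x (next_cell p x) (p.1 x).
Proof.
move=> vp xu; have [np st] := cstc_step vp xu.
have [e _ _] := next_cell_step np st; split=> //; last first.
  exists (false, ord0); rewrite next_cell_dcell //.
have [px|px] := eqVneq (p.1 x) x.
  (* A source cannot be fixed by [p], since it is already the image of its sink. *)
  rewrite px; have [//|[i xi]] := chamber_up_down xu.
  have := vp => /forallP/(_ (cstc_sink w i)).
  have ex : is_exit (@cstc_sink n w) (cstc_sink w i) by apply/existsP; exists i.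
  rewrite /= ex /=; case: (p.2 _) => //.
  rewrite teleport_exit; last exact: cstc_sink_inj.
  rewrite -xi -[X in _ == X]px => /eqP/perm_inj ix.
  by move: xu; rewrite -ix (negPf (sink_not_chamber ex)).
have mx : x \in moving p by rewrite !inE px orbT.
have mz : p.1 x \in moving p by rewrite moving_perm.
move: st; rewrite (negPf px) /=; have := moving_below vp mz; have := moving_above vp mx.
rewrite chamber_downE /grid_step /left_step /down_step; move: (p.1 x) => z; lia.
Qed.

Lemma cstc_choice_ext p p' : cstc_choice p -> cstc_choice p' ->
  {in chamber_up n w, next_cell p =1 next_cell p'} -> p = p'.
Proof.
move=> vp vp' e.
have h x : p.1 x = p'.1 x /\ p.2 x = p'.2 x.
  have [xu|xu] := boolP (x \in chamber_up n w).
    have := e x xu; have [np st] := cstc_step vp xu; have [np' st'] := cstc_step vp' xu.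
    by rewrite !next_cell_dcell // => /dcell_inj->; rewrite (negPf np) (negPf np').
  have [ex|nx] := boolP (is_exit (@cstc_sink n w) x); last first.
    have [np ->] := cstc_fixed vp xu nx; have [np' ->] := cstc_fixed vp' xu nx.
    by rewrite (negPf np) (negPf np').
  have := forallP vp x; have := forallP vp' x; rewrite /= ex /=.
  case/existsP: ex => i /eqP->; case: (p.2 _) => //; case: (p'.2 _) => //.
  by rewrite !teleport_exit; do ?[exact: cstc_sink_inj] => /eqP-> /eqP->.
case: p p' h {vp vp' e} => s b [s' b'] /= h; congr (_, _).
  by apply/permP=> x; have [] := h x.
by apply/ffunP=> x; have [] := h x.
Qed.

Lemma cstc_choice_real (phi : T -> cell N) (zeta : T -> T) :
  (forall x, x \in chamber_up n w -> cstc_linked x (phi x) (zeta x)) ->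
  {in chamber_up n w &, injective zeta} ->
  exists2 p, cstc_choice p & {in chamber_up n w, next_cell p =1 phi}.
Proof.
move=> lk zi.
pose sink x := [pick i | x == @cstc_sink n w i].
(* [zeta] is prescribed only inside the sector; teleports from the sinks and fixed points elsewhere
   extend it to a permutation. *)
pose xi x := if x \in chamber_up n w then zeta x
             else if sink x is Some i then cstc_source w i else x.
have xi_up x : x \in chamber_up n w -> xi x = zeta x by rewrite /xi => ->.
have xi_sink i : xi (cstc_sink w i) = cstc_source w i.
  have ex : is_exit (@cstc_sink n w) (cstc_sink w i) by apply/existsP; exists i.
  rewrite /xi (negPf (sink_not_chamber ex)) /sink; case: pickP => [j /eqP/cstc_sink_inj->//|].
  by move/(_ i); rewrite eqxx.
have xi_fix x : x \notin chamber_up n w -> ~~ is_exit (@cstc_sink n w) x -> xi x = x.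
  move=> nu nx; rewrite /xi (negPf nu) /sink; case: pickP => // i /eqP e.
  by case/existsP: nx; exists i; apply/eqP.
have xi_down x : x \in chamber_up n w -> xi x \in chamber_down n w.
  by move=> xu; rewrite xi_up //; case: (lk x xu).
have trichotomy x : [\/ x \in chamber_up n w, exists i, x = cstc_sink w i |
   x \notin chamber_up n w /\ ~~ is_exit (@cstc_sink n w) x].
  have [xu|xu] := boolP (x \in chamber_up n w); first exact: Or31.
  have [/existsP[i /eqP ->]|nx] := boolP (is_exit (@cstc_sink n w) x); last exact: Or33.
  by apply: Or32; exists i.
have fix_down x : x \notin chamber_up n w -> ~~ is_exit (@cstc_sink n w) x ->
    x \notin chamber_down n w.
  by move=> nu nx; apply: contra nu => xd; exact: chamber_down_up.
have fix_source x i : x \notin chamber_up n w -> ~~ is_exit (@cstc_sink n w) x ->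
    x <> cstc_source w i.
  move=> nu nx xs; move: nu nx; rewrite xs is_exitE chamber_upE gcol_point grow_point.
  by have := ltn_ord i; lia.
have source_inj : injective (@cstc_source n w).
  move=> i j /(congr1 (@gcol _ _)); rewrite !gcol_point => h; apply/val_inj.
  by move: h => /=; lia.
have xi_inj : injective xi.
  have aux x z : xi x = xi z -> x \in chamber_up n w -> x = z.
    move=> e xu; have xd := xi_down x xu; case: (trichotomy z) => [zu|[i zi']|[nz nzx]].
    - by apply: zi => //; rewrite -!xi_up.
    - by move: xd; rewrite e zi' xi_sink (negPf (source_not_chamber _ _)).
    by move: xd; rewrite e xi_fix // (negPf (fix_down _ nz nzx)).
  move=> x z e; case: (trichotomy x) => [xu|[i xi']|[nx nxx]]; first exact: aux.
    case: (trichotomy z) => [zu|[j zj]|[nz nzx]]; first by apply/esym/aux.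
      by move: e; rewrite xi' zj !xi_sink => /source_inj->.
    by move: e; rewrite xi' xi_sink (xi_fix z) // => /esym/(fix_source _ _ nz nzx).
  case: (trichotomy z) => [zu|[j zj]|[nz nzx]]; first by apply/esym/aux.
    by move: e; rewrite zj xi_sink (xi_fix x) // => /(fix_source _ _ nx nxx).
  by rewrite -(xi_fix x) // -(xi_fix z).
have spec x : x \in chamber_up n w ->
    ((zeta x == x) || grid_step x (zeta x)) && (phi x == dcell (zeta x)).
  move=> xu; have [e zd [g pE]] := lk x xu.
  have cx : chamber (ucell x) by move: xu; rewrite inE.
  have cz : chamber (dcell (zeta x)) by move: zd; rewrite inE.
  have dphi : distinct (phi x) by rewrite pE dih_distinct chamber_distinct.
  (* Neighbours differ by one in a single coordinate, so leaving the sector takes a triangle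
     bisected by an axis, which [dphi] rules out. *)
  have cphi : chamber (phi x).
    move: e cx dphi; rewrite /share_edge /chamber /distinct; lia.
  have pE' : phi x = dcell (zeta x) by rewrite pE; apply: chamber_dih => //; rewrite -pE.
  by rewrite pE' eqxx andbT; apply: share_edge_step; rewrite -pE'.
pose b := [ffun x : T => is_exit (@cstc_sink n w) x].
pose p : choice := (perm xi_inj, b).
have vp : cstc_choice p.
  apply/forallP=> x; rewrite /= ffunE permE; case: ifP => [/existsP[i /eqP->]|nx].
    by rewrite xi_sink; apply/existsP; exists i; rewrite !eqxx.
  rewrite nx /=; have [xu|nu] := boolP (x \in chamber_up n w).
    by rewrite xi_up //; have /andP[] := spec x xu.
  by rewrite xi_fix ?eqxx ?nx.
exists p => // x xu; have [np st] := cstc_step vp xu.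
rewrite next_cell_dcell // permE xi_up //.
by have /andP[_ /eqP->] := spec x xu.
Qed.
End CSTCTilings2.

Lemma CSTC_card n w : CSTC (2 * n) (2 * w) = #|[set p | @cstc_choice n w p]|.
Proof.
rewrite -(@card_invariant_tilings (3 * (2 * n) + 2 * w) _ _ _ (fun g => @dih _ g)
  (holed_hexagon (2 * n) (2 * w)) (axis_lozenges n w) _ _ _ _ _ _ _ _ _ _ (@ucell (2 * n) (2 * w))
  (@dcell (2 * n) (2 * w)) (chamber_up n w) (chamber_down n w) _ _ _ _ _ _ _ (@cstc_choice n w)
  (fun p x => p.1 x) (@next_cell (2 * n) (2 * w))).
- apply: eq_card => S; rewrite inE [in RHS]inE.
  have [tS|] := boolP (lozenge_tiling _ S) => //=.
  have rot_inj : injective (@rot120 (3 * (2 * n) + 2 * w)).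
    by apply: (@can_inj _ _ _ (rotn 2)); exact: rot120K3.
  have refl_inj : injective (@refl (3 * (2 * n) + 2 * w)).
    exact: can_inj (@reflK _).
  have dih_inj g : injective (@dih (3 * (2 * n) + 2 * w) g).
    by have [h [hK _]] := @dihV (3 * (2 * n) + 2 * w) g; exact: can_inj hK.
  apply/andP/andP => [[irot irefl]|[/forallP inv _]]; last first.
    by split; [exact: (inv (false, @Ordinal 3 1 isT)) | exact: (inv (true, @Ordinal 3 0 isT))].
  have inv g B : B \in S -> dih g @: B \in S.
    move=> BS; rewrite (_ : dih g @: B = rotn g.2 @: ((if g.1 then @refl _ else id) @: B)); last first.
      by rewrite -imset_comp; apply: eq_imset => c; rewrite /dih /=; case: g.1.
    have : (if g.1 then @refl _ else id) @: B \in S.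
      case: g.1; first exact: (invariant_tilingP _ refl_inj irefl).
      by rewrite imset_id.
    move: (_ @: B) => {BS}B BS.
    elim: (nat_of_ord g.2) => [|k IH]; first by rewrite (eq_imset (g := id)) ?imset_id.
    rewrite (eq_imset (g := fun c => rot120 (rotn k c))) // (imset_comp (@rot120 _)).
    exact: (invariant_tilingP _ rot_inj irot).
  split; last exact: axis_forced inv.
  by apply/forallP=> g; apply/(invariant_tilingP _ (dih_inj g)) => B; exact: inv.
- by exists (false, ord0).
- exact: dihM.
- exact: dihV.
- exact: dih_edge.
- exact: dih_hexagon.
- by move=> c; rewrite hexagonE => /andP[].
- move=> _ /imsetP[u ua ->]; have [e mH _] := mate_spec ua; split.
    by apply/lozengeP; exists u, (mate u).
  by apply/subsetP=> c /set2P[]->//; case/and3P: ua.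
- exact: trivIset_axis.
- exact: dih_axis.
- by move=> g g' c; rewrite off_axis => /andP[]; exact: dih_free.
- by move=> x; rewrite off_axis ucell_hexagon inE => /chamber_distinct.
- by move=> x _; exact: ucell_up.
- by move=> x; rewrite off_axis dcell_hexagon inE => /chamber_distinct.
- move=> c; rewrite off_axis => /andP[cH dc] uc; have [g cg] := chamber_repr dc.
  have gH := dih_hexagon g cH; have [h1 h3] := chamber_sector gH cg.
  have [x xE] := ucell_of gH (dih_up g uc) h1 h3.
  have [h [hK _]] := @dihV (3 * (2 * n) + 2 * w) g; exists h; exists x.
    by rewrite inE -xE.
  by rewrite -xE hK.
- move=> c; rewrite off_axis => /andP[cH dc] uc; have [g cg] := chamber_repr dc.
  have gH := dih_hexagon g cH; have [h1 h3] := chamber_sector gH cg.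
  have [x xE] := dcell_of gH (dih_down g uc) h1 h3.
  have [h [hK _]] := @dihV (3 * (2 * n) + 2 * w) g; exists h; exists x.
    by rewrite inE -xE.
  by rewrite -xE hK.
- move=> g x x'; rewrite !inE => cx cx' e; apply: (@ucell_inj (2 * n) (2 * w)).
  by rewrite -e chamber_dih // e.
- move=> g x x'; rewrite !inE => cx cx' e; apply: (@dcell_inj (2 * n) (2 * w)).
  by rewrite -e chamber_dih // e.
- exact: cstc_next_linked.
- by move=> p vp x x' _ _; exact: perm_inj.
- move=> p z vp zd; exists ((p.1)^-1%g z); last by rewrite permKV.
  have : p.1 ((p.1^-1)%g z) = z by rewrite permKV.
  move: ((p.1^-1)%g z) => x xz.
  have [//|xu] := boolP (x \in chamber_up n w).
  have [ex|nx] := boolP (is_exit (@cstc_sink n w) x).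
    have /forallP/(_ x) := vp; rewrite /= ex xz /=; case: (p.2 x) => //.
    case/existsP=> i /andP[_ /eqP zs]; move: zd.
    by rewrite zs (negPf (source_not_chamber _ _)).
  have [_ xx] := cstc_fixed vp xu nx.
  by case/negP: xu; apply: chamber_down_up nx; rewrite -xx xz.
- exact: cstc_choice_ext.
exact: cstc_choice_real.
Qed.

Local Open Scope ring_scope.

(** * From integer determinants to the identity over the rationals *)

Lemma map_cs_mx (R : comNzRingType) y m : map_mx intr (cs_mx int y m) = cs_mx R y m.
Proof.
by apply/matrixP=> i j; rewrite !mxE rmorphD /= !rmorph_nat.
Qed.

Lemma map_cstc_mx (R : comNzRingType) x n : map_mx intr (cstc_mx int x n) = cstc_mx R x n.
Proof. by apply/matrixP=> i j; rewrite !mxE rmorph_nat. Qed.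

Lemma CS_det m y : (CS m y)%:R = \det (cs_mx rat y m).
Proof. by rewrite -map_cs_mx det_map_mx -card_cs_choice CS_card rmorph_nat. Qed.

Lemma CSTC_det n w : (CSTC (2 * n) (2 * w))%:R = \det (cstc_mx rat w n).
Proof. by rewrite -map_cstc_mx det_map_mx -card_cstc_choice CSTC_card rmorph_nat. Qed.

Theorem corollary4p3 (n x : nat) (hn : (1 <= n)%N) :
  (CSTC (2 * n) (2 * x))%:R =
    1 / 2 ^+ n *
    \prod_(0 <= k < n)
      ((CS (2 * k + 1) (2 * x))%:R / (CS (2 * k) (2 * x))%:R) :> rat.
Proof.
under eq_bigr do rewrite !CS_det.
rewrite CSTC_det (_ : (2 * x = x + x)%N); last by rewrite mul2n addnn.
rewrite prod_cs_ratio // => [|m]; first by rewrite mul1r mulKf // expf_neq0.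
(* D_m counts tilings, at least one of which exists, so no denominator vanishes. *)
by rewrite -CS_det pnatr_eq0 -lt0n CS_card cs_choice_gt0.
Qed.
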